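(* If a signed graph $\widehat{H}$ is switching equivalent to $\widehat{H}_0$, or to $\widehat{H}_1$, or to $\widehat{H}_\ell$ for some odd $\ell\ge 3$, then $\textsc{List-S-Hom}(\widehat{H})$ is polynomial-time solvable.
   Context: A signed graph $\widehat{H}$ consists of a vertex set $V(H)$ and two symmetric binary relations on it: positive (blue) edges and negative (red) edges. Its underlying graph $H$ has edge set the union of the two relations. A blue edge and a red edge with the same endpoints form a bicoloured edge; an edge not part of such a pair is unicoloured. Switching at a vertex $v$ changes the sign of every non-loop edge incident with $v$; two signed graphs are switching equivalent if one can be obtained from the other by a sequence of switchings. A sign-preserving homomorphism $\widehat{G}\to\widehat{H}$ is a map $f:V(G)\to V(H)$ such that for every blue (resp. red) edge $xy$ of $\widehat{G}$, $f(x)f(y)$ is a blue (resp. red) edge of $\widehat{H}$ (possibly one of the two edges of a bicoloured edge). A homomorphism $\widehat{G}\to\widehat{H}$ is a map $f$ such that there is a signed graph $\widehat{G}'$ switching equivalent to $\widehat{G}$ for which $f$ is a sign-preserving homomorphism $\widehat{G}'\to\widehat{H}$. For fixed $\widehat{H}$, $\textsc{List-S-Hom}(\widehat{H})$ takes as input a signed graph $\widehat{G}$ with lists $L(v)\subseteq V(H)$, $v\in V(G)$, and asks whether there is a homomorphism $f:\widehat{G}\to\widehat{H}$ with $f(v)\in L(v)$ for all $v$. $\widehat{H}_0$ is the 4-cycle with all four edges unicoloured blue. $\widehat{H}_1$ has vertices $b,t_1,t_2,w,s_1,s_2$, unicoloured blue edges $bt_1,t_1t_2,t_2w,bs_1,s_2w$,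 a unicoloured red edge $s_1s_2$, and a bicoloured edge $bw$, and no other edges. For odd $\ell\ge3$, $\widehat{H}_\ell$ has vertices $b=t_0,t_1,\dots,t_\ell=w,s_1,s_2$, unicoloured blue edges forming the paths $b s_1 s_2 w$ and $t_0t_1\ldots t_\ell$, and bicoloured edges $t_it_j$ for all even $i$ and odd $j$ with $j>i+1$, and no other edges. *)

(* Defs.v *)
From mathcomp Require Import all_boot.

Set Implicit Arguments.
Unset Strict Implicit.
Unset Printing Implicit Defensive.

(** * Signed graphs *)

(* Loops are allowed; a pair related by both [blue] and [red] is a bicoloured
   edge. *)
Record signed_graph (V : finType) := SignedGraph {
  blue : rel V;
  red : rel V;
  blue_sym : symmetric blue;
  red_sym : symmetric red
}.

Definition sym_closure (T : Type) (e : rel T) : rel T :=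
  fun x y => e x y || e y x.

Lemma sym_closure_sym (T : Type) (e : rel T) : symmetric (sym_closure e).
Proof. by move=> x y; rewrite /sym_closure orbC. Qed.

Definition signed_graph_of (V : finType) (b r : rel V) : signed_graph V :=
  SignedGraph (sym_closure_sym b) (sym_closure_sym r).

(* [(x == v) (+) (y == v)] says that [xy] is a non-loop edge incident
   with [v]. *)
Definition switch_rel (V : finType) (v : V) (e e' : rel V) : rel V :=
  fun x y => if (x == v) (+) (y == v) then e' x y else e x y.

Lemma switch_rel_sym (V : finType) (v : V) (e e' : rel V) :
  symmetric e -> symmetric e' -> symmetric (switch_rel v e e').
Proof. by move=> se se' x y; rewrite /switch_rel addbC se se'. Qed.

Definition switch (V : finType) (G : signed_graph V) (v : V) :
    signed_graph V :=
  SignedGraph (switch_rel_sym v (@blue_sym V G) (@red_sym V G))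
              (switch_rel_sym v (@red_sym V G) (@blue_sym V G)).

Definition switching_equivalent (V : finType) (G G' : signed_graph V) : Prop :=
  exists s : seq V,
    blue (foldl (@switch V) G s) =2 blue G' /\
    red (foldl (@switch V) G s) =2 red G'.

Definition isomorphic (V W : finType) (G : signed_graph V)
    (H : signed_graph W) : Prop :=
  exists2 f : V -> W, bijective f &
    forall x y, blue H (f x) (f y) = blue G x y /\
                red H (f x) (f y) = red G x y.

(* Switching equivalence compares signed graphs on one vertex set; to compare
   with a concretely given graph, vertices are renamed. *)
Definition switching_equivalent_to_copy (V W : finType) (G : signed_graph V)
    (H : signed_graph W) : Prop :=
  exists2 G' : signed_graph V, switching_equivalent G G' & isomorphic G' H.

Definition sign_preserving (V W : finType) (G : signed_graph V)
    (H : signed_graph W) (f : V -> W) : Prop :=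
  forall x y, (blue G x y -> blue H (f x) (f y)) /\
              (red G x y -> red H (f x) (f y)).

Definition homomorphism (V W : finType) (G : signed_graph V)
    (H : signed_graph W) (f : V -> W) : Prop :=
  exists2 G' : signed_graph V,
    switching_equivalent G G' & sign_preserving G' H f.

(** * The target graphs *)

Definition edges (n : nat) (s : seq (nat * nat)) : rel 'I_n :=
  fun x y => (val x, val y) \in s.

Definition H0 : signed_graph 'I_4 :=
  signed_graph_of (@edges 4 [:: (0, 1); (1, 2); (2, 3); (3, 0)])
                  (@edges 4 [::]).

(* The vertices b, t_1, t_2, w, s_1, s_2 are 0, 1, 2, 3, 4, 5. *)
Definition H1 : signed_graph 'I_6 :=
  signed_graph_of
    (@edges 6 [:: (0, 1); (1, 2); (2, 3); (0, 4); (5, 3); (0, 3)])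
    (@edges 6 [:: (4, 5); (0, 3)]).

(* [inl i] is t_i (so b is [inl 0] and w is [inl l]), [inr false] is s_1 and
   [inr true] is s_2. *)
Definition Hl_vertex (l : nat) : finType := ('I_l.+1 + bool)%type.

Definition Hl_bicoloured (l : nat) : rel (Hl_vertex l) :=
  fun x y => match x, y with
  | inl i, inl j => [&& ~~ odd i, odd j & i.+1 < j]
  | _, _ => false
  end.

Definition Hl_unicoloured (l : nat) : rel (Hl_vertex l) :=
  fun x y => match x, y with
  | inl i, inl j => val j == i.+1
  | inl i, inr s => (val i == 0) && ~~ s
  | inr s, inr s' => ~~ s && s'
  | inr s, inl j => s && (val j == l)
  end.

Definition Hl (l : nat) : signed_graph (Hl_vertex l) :=
  signed_graph_of
    (fun x y => Hl_unicoloured x y || Hl_bicoloured x y)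
    (@Hl_bicoloured l).

(** * Polynomial time: deterministic multi-tape Turing machines *)

(* Cells hold a blank ([None]), an input bit, or a symbol of the machine's own
   finite work alphabet. *)
Definition cell (A : finType) : finType := option (bool + A).

Inductive move := MoveLeft | Stay | MoveRight.

(* Cells to the left of the head are listed from the head outwards; both sides
   are implicitly continued by blanks. *)
Record tape (A : finType) := Tape {
  tape_left : seq (cell A);
  tape_head : cell A;
  tape_right : seq (cell A)
}.

Definition tape_of_word (A : finType) (w : seq (cell A)) : tape A :=
  Tape [::] (head None w) (behead w).

Definition tape_update (A : finType) (t : tape A) (am : cell A * move) :
    tape A :=
  let: Tape l _ r := t in
  let: (a, m) := am in
  match m with
  | MoveLeft => Tape (behead l) (head None l) (a :: r)
  | Stay => Tape l a r
  | MoveRight => Tape (a :: l) (head None r) (behead r)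
  end.

Record turing_machine := TuringMachine {
  tm_tapes : nat;  (* one less than the number of tapes *)
  tm_work : finType;
  tm_state : finType;
  tm_start : tm_state;
  (* [Some true] on accepting, [Some false] on rejecting states *)
  tm_verdict : tm_state -> option bool;
  tm_trans : tm_state -> {ffun 'I_tm_tapes.+1 -> cell tm_work} ->
             tm_state * {ffun 'I_tm_tapes.+1 -> cell tm_work * move}
}.

Record config (M : turing_machine) := Config {
  conf_state : tm_state M;
  conf_tapes : {ffun 'I_(tm_tapes M).+1 -> tape (tm_work M)}
}.

Definition tm_init (M : turing_machine) (w : seq bool) : config M :=
  Config (tm_start M)
    [ffun i => tape_of_word
       (if i == ord0 then [seq Some (inl b) | b <- w] else [::])].

Definition tm_step (M : turing_machine) (c : config M) : config M :=
  let: Config q ts := c in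
  if tm_verdict q is Some _ then c else
  let: (q', am) := tm_trans q [ffun i => tape_head (ts i)] in
  Config q' [ffun i => tape_update (ts i) (am i)].

(* Halting configurations are fixed by [tm_step], so this says that [M] halts
   on [w] within [t] steps with verdict [b]. *)
Definition tm_outputs (M : turing_machine) (w : seq bool) (t : nat) (b : bool) :
    Prop :=
  tm_verdict (conf_state (iter t (@tm_step M) (tm_init M w))) = Some b.

Record decision_problem := DecisionProblem {
  instance : Type;
  encode : instance -> seq bool;
  yes_instance : instance -> Prop
}.

Definition polynomial_time_solvable (P : decision_problem) : Prop :=
  exists (M : turing_machine) (c d : nat),
    forall I : instance P, exists b : bool,
      tm_outputs M (encode I) (c * size (encode I) ^ d + c) b /\
      (b <-> yes_instance I).

(** * The list homomorphism problem *)

Record list_instance (W : finType) := ListInstance {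
  li_order : nat;
  li_graph : signed_graph 'I_li_order;
  li_lists : 'I_li_order -> {set W}
}.

Arguments li_lists {W} l v : rename.

(* The number of vertices in unary, then the blue and the red adjacency
   matrices and the vertex-by-target membership matrix of the lists, all
   row-major. *)
Definition list_instance_encode (W : finType) (I : list_instance W) :
    seq bool :=
  let V := enum 'I_(li_order I) in
  nseq (li_order I) true ++ false ::
    [seq blue (li_graph I) x y | x <- V, y <- V] ++
    [seq red (li_graph I) x y | x <- V, y <- V] ++
    [seq a \in li_lists I x | x <- V, a <- enum W].

Definition list_s_hom_yes (W : finType) (H : signed_graph W)
    (I : list_instance W) : Prop :=
  exists2 f : 'I_(li_order I) -> W,
    homomorphism (li_graph I) H f & forall v, f v \in li_lists I v.

Definition List_S_Hom (W : finType) (H : signed_graph W) : decision_problem :=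
  DecisionProblem (@list_instance_encode W) (@list_s_hom_yes W H).

(* Main.v *)
(* Record a list homomorphism together with its switching as a map into the
   labels [V(H) x bool]: an edge xy of colour c is respected iff the labels
   (a, s), (b, t) of x and y satisfy one binary relation [label_rel H c].  A
   label survives singleton arc consistency if fixing it admits nonempty arc
   consistent domains inside the surviving ones.  Computing the survivors takes
   polynomial time for every H and never discards a solution, so the theorem
   amounts to: for H_0, H_1 and H_l, nonempty survivors yield a solution.

   For H_0 and H_l let f(v) be the least surviving vertex in a min ordering
   whose bicoloured edges are closed downwards.  Then f is a homomorphism of the
   underlying graphs, and a surviving label can be propagated along the edges
   that f sends to unicoloured ones; since it cannot contradict itself, every
   closed walk of such edges is balanced, which gives the switching.  For H_1,
   send a vertex to b or w whenever possible; on the remaining vertices the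
   relation splits into two independent systems of equations between two
   variables modulo 2, and the same propagation argument applies to each. *)
Require Import Defs.
From HB Require Import structures.
From mathcomp Require Import all_boot zify ring.

Set Implicit Arguments.
Unset Strict Implicit.
Unset Printing Implicit Defensive.

(** * A Turing machine for singleton arc consistency *)

Section Machine.

Variables (L : finType) (R : bool -> rel L) (m : nat) (idx : L -> nat).

(* A cell [(D, E, T, P, d)] of the data tape holds the domain [D] of a vertex,
   its domain [E] in the current probe, the labels [T] still to be probed, the
   probed label [P] (empty except at one vertex) and a row marker [d]. *)
Definition store : finType :=
  ({set L} * {set L} * {set L} * {set L} * bool)%type.

(* [Start f pk em]: [f] orders the deletion of the label probed last, [pk]
   records that a new one was picked, [em] that a domain is empty.
   [Fetch c ch X] looks for the next row of the matrix of colour [c] and fetches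
   the domain [X] of its vertex, [Revise c ch X] reads that row, [Lists ch em k]
   the [k]-th bit of a list; [ch] records a change in the current round. *)
Inductive control :=
  | Start of bool & bool & bool
  | Fetch of bool & bool & option {set L}
  | Revise of bool & bool & {set L}
  | Lists of bool & bool & 'I_m.+1
  | Halt of bool.

Definition control_code (q : control) :
    (bool * bool * bool + bool * bool * option {set L} + bool * bool * {set L}
     + bool * bool * 'I_m.+1 + bool)%type :=
  match q with
  | Start f pk em => inl (inl (inl (inl (f, pk, em))))
  | Fetch c ch X => inl (inl (inl (inr (c, ch, X))))
  | Revise c ch X => inl (inl (inr (c, ch, X)))
  | Lists ch em k => inl (inr (ch, em, k))
  | Halt b => inr b
  end.

Definition control_decode x : control :=
  match x with
  | inl (inl (inl (inl (f, pk, em)))) => Start f pk em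
  | inl (inl (inl (inr (c, ch, X)))) => Fetch c ch X
  | inl (inl (inr (c, ch, X))) => Revise c ch X
  | inl (inr (ch, em, k)) => Lists ch em k
  | inr b => Halt b
  end.

Lemma control_codeK : cancel control_code control_decode.
Proof. by case. Qed.

HB.instance Definition _ := Finite.copy control (can_type control_codeK).

(** [Setup] writes one data cell per leading 1 of the input. [Forward] sweeps the data tape to the
    right and [Back] returns; if its flag is set, [Rewind] then takes the input head to the left end
    and [Skip] takes it past the unary prefix. *)
Inductive mode :=
  | Setup
  | Forward of control
  | Back of bool & control
  | Rewind of control
  | Skip of control.

Definition mode_code (q : mode) :
    (unit + control + bool * control + control + control)%type :=
  match q with
  | Setup => inl (inl (inl (inl tt)))
  | Forward q => inl (inl (inl (inr q)))
  | Back r q => inl (inl (inr (r, q)))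
  | Rewind q => inl (inr q)
  | Skip q => inr q
  end.

Definition mode_decode
    (x : unit + control + bool * control + control + control) : mode :=
  match x with
  | inl (inl (inl (inl _))) => Setup
  | inl (inl (inl (inr q))) => Forward q
  | inl (inl (inr (r, q))) => Back r q
  | inl (inr q) => Rewind q
  | inr q => Skip q
  end.

Lemma mode_codeK : cancel mode_code mode_decode.
Proof. by case. Qed.

HB.instance Definition _ := Finite.copy mode (can_type mode_codeK).

Definition nbhd (c : bool) (X : {set L}) : {set L} :=
  [set b | [exists a in X, R c a b]].

(* The row markers are raised by the blue rows and lowered again by the red
   ones, so that they need no resetting. *)
Definition delta (q : control) (x : store) (bit : bool) :
    control * store * bool * bool :=
  let: (D, E, T, P, d) := x in
  match q with
  | Start f pk em =>
      let D1 := if f then D :\: P else D in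
      let T1 := if f then D1 else T in
      let em1 := em || (D1 == set0) in
      if (if pk then None else [pick a in T1]) is Some a
      then (Start f true em1, (D1, [set a], T1 :\ a, [set a], d), true, false)
      else (Start f pk em1, (D1, D1, T1, set0, d), true, false)
  | Fetch c ch X =>
      if (X == None) && (d == c)
      then (Fetch c ch (Some E), (D, E, T, P, ~~ c), true, false)
      else (q, x, true, false)
  | Revise c ch X =>
      let E' := if bit then E :&: nbhd c X else E in
      (Revise c (ch || (E' != E)) X, (D, E', T, P, d), true, true)
  | Lists ch em k =>
      if k < m then
        let E' := [set a in E | (idx a == k) ==> bit] in
        (Lists (ch || (E' != E)) em (inord k.+1), (D, E', T, P, d), false, true)
      else (Lists ch (em || (E == set0)) ord0, x, true, false)
  | Halt _ => (q, x, true, false)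
  end.

(** A round reads the blue rows, the red rows and the lists. A [Fetch] that ends without a domain
    shows that all rows of its colour have been read. The returned flag asks for the input head to
    go back to the blue matrix. *)
Definition sweep_end (q : control) : control * bool :=
  match q with
  | Start _ pk em =>
      if pk then (Fetch false false None, true) else (Halt (~~ em), false)
  | Fetch c ch (Some X) => (Revise c ch X, false)
  | Fetch c ch None =>
      if c then (Lists ch false ord0, false) else (Fetch true ch None, false)
  | Revise c ch _ => (Fetch c ch None, false)
  | Lists ch em _ =>
      if ch then (Fetch false false None, true)
      else (Start em false false, false)
  | Halt b => (q, false)
  end.

Let symbol := cell store.

Definition move_if (b : bool) : move := if b then MoveRight else Stay.

(** The first sweep is a [Start] with [f] true and nothing probed: it deletes no label and fills
    every agenda with the whole domain. *)
Definition trans (q : mode) (a0 a1 : symbol) :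
    mode * (symbol * move) * (symbol * move) :=
  match q with
  | Setup =>
      if a0 is Some (inl true)
      then (Setup, (a0, MoveRight),
            (Some (inr (setT, set0, set0, set0, false)), MoveRight))
      else (Back false (Start true false false),
            (a0, MoveRight), (a1, MoveLeft))
  | Forward q =>
      if a1 is Some (inr x) then
        let: (q', x', dm, im) := delta q x (a0 == Some (inl true)) in
        (Forward q', (a0, move_if im), (Some (inr x'), move_if dm))
      else let: (q', r) := sweep_end q in
        (Back r q', (a0, Stay), (a1, MoveLeft))
  | Back r q =>
      if a1 is Some _ then (Back r q, (a0, Stay), (a1, MoveLeft))
      else if r then (Rewind q, (a0, MoveLeft), (a1, MoveRight))
      else (Forward q, (a0, Stay), (a1, MoveRight))
  | Rewind q =>
      if a0 is Some _ then (Rewind q, (a0, MoveLeft), (a1, Stay))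
      else (Skip q, (a0, MoveRight), (a1, Stay))
  | Skip q =>
      if a0 is Some (inl true) then (Skip q, (a0, MoveRight), (a1, Stay))
      else (Forward q, (a0, MoveRight), (a1, Stay))
  end.

Definition verdict (q : mode) : option bool :=
  if q is Forward (Halt b) then Some b else None.

Definition sac_machine : turing_machine :=
  @TuringMachine 1 store mode Setup verdict
    (fun q h => let: (q', x0, x1) := trans q (h ord0) (h ord_max) in
       (q', [ffun i => if i == ord0 then x0 else x1])).

(** * Tapes up to trailing blanks *)

Let view := (seq symbol * seq symbol)%type.

Definition blank_eq (s t : seq symbol) := nth None s =1 nth None t.

Definition shows (t : tape store) (v : view) :=
  blank_eq (tape_left t) v.1 /\ blank_eq (tape_head t :: tape_right t) v.2.

Definition view_update (v : view) (am : symbol * move) : view :=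
  let: (l, r) := v in let: (a, mv) := am in
  match mv with
  | MoveLeft => (behead l, head None l :: a :: behead r)
  | Stay => (l, a :: behead r)
  | MoveRight => (a :: l, behead r)
  end.

Lemma shows_update t v am :
  shows t v -> shows (tape_update t am) (view_update v am).
Proof.
case: t v am => [l a r] [l' r'] [b mv] [/= hl hr].
have hl0 : head None l = head None l' by rewrite -!nth0 hl.
have hbl : blank_eq (behead l) (behead l') by move=> i; rewrite !nth_behead.
have hbr : blank_eq r (behead r') by move=> i; rewrite nth_behead -hr.
case: mv; split=> //=.
- by rewrite hl0 => -[|[|i]] //=; rewrite hbr.
- by case=> [|i] //=; rewrite hbr.
- by case=> [|i] //=; rewrite hl.
- by case=> [|i] /=; rewrite -hbr ?nth0 // nth_behead.
Qed.

Let vconfig := (mode * view * view)%type.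

Definition cshows (c : config sac_machine) (V : vconfig) :=
  [/\ conf_state c = V.1.1, shows (conf_tapes c ord0) V.1.2
    & shows (conf_tapes c ord_max) V.2].

(** Bounding the number of steps, instead of fixing it, lets estimates be added and weakened
    freely. *)
Definition reach (t : nat) (V V' : vconfig) :=
  forall c, cshows c V ->
    exists2 k, k <= t & cshows (iter k (@tm_step sac_machine) c) V'.

Lemma reach_refl V : reach 0 V V.
Proof. by move=> c cV; exists 0. Qed.

Lemma reach_trans t1 t2 V1 V2 V3 :
  reach t1 V1 V2 -> reach t2 V2 V3 -> reach (t1 + t2) V1 V3.
Proof.
move=> r1 r2 c /r1[k1 k1t /r2[k2 k2t h]]; exists (k2 + k1).
  by rewrite addnC leq_add.
by rewrite iterD.
Qed.

Lemma reach_le t t' V V' : t <= t' -> reach t V V' -> reach t' V V'.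
Proof. by move=> tt' r c /r[k kt h]; exists k => //; exact: leq_trans tt'. Qed.

Lemma reach_step q v0 v1 :
  verdict q = None ->
  let: (q', x0, x1) := trans q (head None v0.2) (head None v1.2) in
  reach 1 (q, v0, v1) (q', view_update v0 x0, view_update v1 x1).
Proof.
case E: trans => [[q' x0] x1] vq [q1 ts] [/= -> s0 s1]; exists 1 => //=.
rewrite vq; rewrite !ffunE.
have -> : tape_head (ts ord0) = head None v0.2.
  by case: s0 => _ /(_ 0) /=; rewrite nth0.
have -> : tape_head (ts ord_max) = head None v1.2.
  by case: s1 => _ /(_ 0) /=; rewrite nth0.
by rewrite E; split=> //=; rewrite !ffunE; apply: shows_update.
Qed.

Definition view_eq (v v' : view) := blank_eq v.1 v'.1 /\ blank_eq v.2 v'.2.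

Lemma view_eq_refl v : view_eq v v.
Proof. by []. Qed.

Lemma reach_one q v0 v1 q' x0 x1 v0' v1' :
  verdict q = None ->
  trans q (head None v0.2) (head None v1.2) = (q', x0, x1) ->
  view_eq (view_update v0 x0) v0' -> view_eq (view_update v1 x1) v1' ->
  reach 1 (q, v0, v1) (q', v0', v1').
Proof.
move=> vq tq [e1 e2] [e3 e4] c cV.
have := reach_step v0 v1 vq; rewrite tq => /(_ c cV)[k k1 [h1 [h2 h3] [h4 h5]]].
exists k => //; split=> //=; split.
- exact: ftrans h2 e1.
- exact: ftrans h3 e2.
- exact: ftrans h4 e3.
- exact: ftrans h5 e4.
Qed.

(** * Sweeps over the data tape *)

Variables (n : nat) (w : seq bool).

Let word : seq symbol := [seq Some (inl b) | b <- w].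

Definition at_input (p : nat) : view := (rev (take p word), drop p word).

(** [f'] gives the cells already rewritten in the current sweep, [f] those still to be read. *)
Definition at_cell (f' f : nat -> store) (k : nat) : view :=
  (rev [seq Some (inr (f' i)) | i <- iota 0 k],
   [seq Some (inr (f i)) | i <- iota k (n - k)]).

Lemma head_at_input p :
  p < size w -> head None (at_input p).2 = Some (inl (nth false w p)).
Proof.
by move=> pw; rewrite /= -nth0 nth_drop addn0 (nth_map false).
Qed.

Lemma head_at_inputT p :
  head None (at_input p).2 == Some (inl true) = nth false w p.
Proof.
case: (ltnP p (size w)) => pw; last first.
  by rewrite nth_default //= drop_oversize // size_map.
by rewrite head_at_input //; case: nth.
Qed.

Lemma at_input_right p : p < size w ->
  view_update (at_input p) (head None (at_input p).2, MoveRight) =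
  at_input p.+1.
Proof.
move=> pw; have pw' : p < size word by rewrite size_map.
rewrite /at_input /= (take_nth None) // rev_rcons (drop_nth None) //=.
Qed.

Lemma at_input_left p : p < size w ->
  view_eq (view_update (at_input p.+1) (head None (at_input p.+1).2, MoveLeft))
          (at_input p).
Proof.
move=> pw; have pw' : p < size word by rewrite size_map.
rewrite /at_input /= (take_nth None) // rev_rcons.
split=> //= -[|i]; rewrite (drop_nth None pw') //=.
by case: (drop p.+1 word) => //; case: i => [|[|i]].
Qed.

Lemma head_at_cell f' f k :
  k < n -> head None (at_cell f' f k).2 = Some (inr (f k)).
Proof. by move=> kn; rewrite /= -[n - k]prednK ?subn_gt0. Qed.

Lemma rev_cells (f : nat -> store) k :
  rev [seq Some (inr (f i)) | i <- iota 0 k.+1] =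
  Some (inr (f k)) :: rev [seq Some (inr (f i)) | i <- iota 0 k] :> seq symbol.
Proof. by rewrite -addn1 iotaD map_cat rev_cat. Qed.

Lemma at_cell_right f' f k : k < n ->
  view_update (at_cell f' f k) (Some (inr (f' k)), MoveRight) =
  at_cell f' f k.+1.
Proof.
by move=> kn; rewrite /at_cell rev_cells -[n - k]prednK ?subn_gt0 //= -subnS.
Qed.

Lemma view_stay v : view_eq (view_update v (head None v.2, Stay)) v.
Proof.
by case: v => l r; split=> //= i; case: r => //=; case: i => [|[|i]].
Qed.

(** The index is shifted by one so that 0 stands for the blank to the left of all cells, where
    [Back] turns round. *)
Definition before_cell (f : nat -> store) (k : nat) : view :=
  if k is j.+1 then at_cell f f j
  else ([::], None :: [seq Some (inr (f i)) | i <- iota 0 n]).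

Lemma at_cell_left f k : k <= n ->
  view_eq (view_update (at_cell f f k) (head None (at_cell f f k).2, MoveLeft))
          (before_cell f k).
Proof.
case: k => [|k] kn.
  rewrite /at_cell subn0; split=> //= i.
  by case: (iota 0 n) => [|? ?]; case: i => [|[|[|i]]].
rewrite /at_cell rev_cells /=; split=> //=.
rewrite -[n - k]prednK ?subn_gt0 // -subnS => -[|i] //=.
by case: (iota k.+1 _) => //=; case: i => [|[|i]].
Qed.

Lemma back_loop r q v0 f k : k <= n ->
  reach k (Back r q, v0, before_cell f k) (Back r q, v0, before_cell f 0).
Proof.
elim: k => [|k IHk] kn; first exact: reach_refl.
rewrite -add1n; apply: reach_trans (IHk (ltnW kn)).
apply: (reach_one (x0 := (head None v0.2, Stay))
                  (x1 := (Some (inr (f k)), MoveLeft))) => //.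
- by rewrite [before_cell f k.+1]/= head_at_cell.
- exact: view_stay.
- by have := at_cell_left f (ltnW kn); rewrite head_at_cell.
Qed.

Hypothesis size_w : n < size w.
Hypothesis w_prefix : forall i, i <= n -> nth false w i = (i < n).

Let input_left : view := ([::], None :: word).

Lemma rewind_loop q f k : k < size w ->
  reach k.+1 (Rewind q, at_input k, at_cell f f 0)
             (Rewind q, input_left, at_cell f f 0).
Proof.
elim: k => [|k IHk] kw.
  apply: (reach_one (x0 := (head None (at_input 0).2, MoveLeft))
                    (x1 := (head None (at_cell f f 0).2, Stay))) => //.
  - by rewrite head_at_input.
  - rewrite /at_input /= take0 drop0; split=> //= i.
    by move: kw; case: w @word => //= b s word _; case: i => [|[|i]].
  - exact: view_stay.
rewrite -add1n; apply: reach_trans (IHk (ltnW kw)).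
apply: (reach_one (x0 := (head None (at_input k.+1).2, MoveLeft))
                  (x1 := (head None (at_cell f f 0).2, Stay))) => //.
- by rewrite head_at_input.
- exact: at_input_left (ltnW kw).
- exact: view_stay.
Qed.

Lemma skip_loop q v1 k : k <= n ->
  reach k (Skip q, at_input 0, v1) (Skip q, at_input k, v1).
Proof.
elim: k => [|k IHk] kn; first exact: reach_refl.
rewrite -[X in reach X]addn1; apply: reach_trans (IHk (ltnW kn)) _.
have kw : k < size w by apply: ltn_trans size_w.
apply: (reach_one (x0 := (head None (at_input k).2, MoveRight))
                  (x1 := (head None v1.2, Stay))) => //.
- by rewrite head_at_input // w_prefix ?kn // ltnW.
- by rewrite at_input_right //; apply: view_eq_refl.
- exact: view_stay.
Qed.

(** Position [n.+1] follows the unary prefix and its closing zero: it is the first bit of the blue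
    matrix. *)
Lemma rewind q f p : 0 < p <= size w ->
  reach (p + n + 3) (Back true q, at_input p, before_cell f 0)
                    (Forward q, at_input n.+1, at_cell f f 0).
Proof.
case: p => // p /= pw.
have -> : p.+1 + n + 3 = 1 + (p.+1 + (1 + (n + 1))) by lia.
apply: (@reach_trans _ _ _ (Rewind q, at_input p, at_cell f f 0)).
  apply: (reach_one (x0 := (head None (at_input p.+1).2, MoveLeft))
                    (x1 := (None, MoveRight))) => //; first exact: at_input_left.
  by rewrite /at_cell subn0; split=> //= -[|[|i]].
apply: reach_trans (@rewind_loop q f p pw) _.
apply: (@reach_trans _ _ _ (Skip q, at_input 0, at_cell f f 0)).
  apply: (reach_one (x0 := (None, MoveRight))
                    (x1 := (head None (at_cell f f 0).2, Stay))) => //.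
    by rewrite /at_input take0 drop0; split=> //= -[|[|i]].
  exact: view_stay.
apply: reach_trans (@skip_loop q _ n (leqnn n)) _.
apply: (reach_one (x0 := (head None (at_input n).2, MoveRight))
                  (x1 := (head None (at_cell f f 0).2, Stay))) => //.
- by rewrite head_at_input // w_prefix // ltnn.
- by rewrite at_input_right //; apply: view_eq_refl.
- exact: view_stay.
Qed.

Definition at_sweep (q : control) (p : nat) (f : nat -> store) : vconfig :=
  (Forward q, at_input p, at_cell f f 0).

Lemma back_home q p f :
  reach n.+1 (Back false q, at_input p, before_cell f n) (at_sweep q p f).
Proof.
rewrite -addn1; apply: reach_trans (@back_loop false q _ f n (leqnn n)) _.
apply: (reach_one (x0 := (head None (at_input p).2, Stay))
                  (x1 := (None, MoveRight))) => //.
- exact: view_stay.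
- by rewrite /at_cell subn0; split=> //= -[|[|i]].
Qed.

(** A common bound for all sweeps: at most [m.+1] steps on each cell, then the way back and a
    possible rewinding. *)
Definition time : nat := (m + 9) * (size w).+1.

Lemma sweep_loop (st : nat -> control) (pos : nat -> nat) f f' t k :
  (forall i, i < n ->
    reach t (Forward (st i), at_input (pos i), at_cell f' f i)
            (Forward (st i.+1), at_input (pos i.+1), at_cell f' f i.+1)) ->
  k <= n ->
  reach (k * t) (Forward (st 0), at_input (pos 0), at_cell f f 0)
                (Forward (st k), at_input (pos k), at_cell f' f k).
Proof.
move=> h; elim: k => [|k IHk] kn; first exact: reach_refl.
by rewrite mulSn addnC; apply: reach_trans (IHk (ltnW kn)) (h _ kn).
Qed.

(** Reduces a sweep to its behaviour on one cell: [st i] and [pos i] are the control and the input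
    position on arrival at cell [i]. *)
Lemma sweep (st : nat -> control) (pos : nat -> nat) f f' t q' r :
  (forall i, i < n ->
    reach t (Forward (st i), at_input (pos i), at_cell f' f i)
            (Forward (st i.+1), at_input (pos i.+1), at_cell f' f i.+1)) ->
  t <= m.+1 -> 0 < pos n <= size w -> verdict (Forward (st n)) = None ->
  sweep_end (st n) = (q', r) ->
  reach time (at_sweep (st 0) (pos 0) f)
             (at_sweep q' (if r then n.+1 else pos n) f').
Proof.
move=> h tm posn vst qr.
have {h} h := sweep_loop h (leqnn n).
suff: reach (n * t + (1 + (n + (pos n + n + 3))))
            (at_sweep (st 0) (pos 0) f)
            (at_sweep q' (if r then n.+1 else pos n) f').
  apply: reach_le; rewrite /time.
  have : n * t <= n * m.+1 by rewrite leq_mul2l tm orbT.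
  move: posn size_w; clear; move: (pos n) (n * t) (size w) => p nt s; nia.
apply: reach_trans h _.
have cn : at_cell f' f n = at_cell f' f' n by rewrite /at_cell subnn.
apply: (@reach_trans _ _ _ (Back r q', at_input (pos n), before_cell f' n)).
  apply: (reach_one (x0 := (head None (at_input (pos n)).2, Stay))
                    (x1 := (head None (at_cell f' f' n).2, MoveLeft))) => //.
  - by rewrite cn /= subnn /= qr.
  - exact: view_stay.
  - by rewrite cn; apply: at_cell_left.
case: r {qr} => /=.
  exact: reach_trans (@back_loop true q' _ f' n (leqnn n)) (@rewind q' f' _ posn).
by apply: reach_le (@back_home q' (pos n) f'); lia.
Qed.

Lemma cell_step q p (f f' : nat -> store) k q' dm im :
  k < n -> verdict (Forward q) = None ->
  delta q (f k) (nth false w p) = (q', f' k, dm, im) ->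
  (im -> p < size w) -> dm ->
  reach 1 (Forward q, at_input p, at_cell f' f k)
          (Forward q', at_input (p + im), at_cell f' f k.+1).
Proof.
move=> kn vq dq pw dmT; rewrite dmT in dq.
apply: (reach_one (x0 := (head None (at_input p).2, move_if im))
                  (x1 := (Some (inr (f' k)), MoveRight))) => //.
- by rewrite head_at_cell // /trans head_at_inputT dq.
- case: im pw dq => [|_ _]; last by rewrite addn0; apply: view_stay.
  by move=> /(_ isT) pw _; rewrite at_input_right // addn1; apply: view_eq_refl.
- by rewrite at_cell_right //; apply: view_eq_refl.
Qed.

(** * One round of arc consistency *)

Hypothesis size_wE : size w = n.+1 + 2 * (n * n) + n * m.

(** The colour is read as a number, since the red matrix lies one block of [n * n] bits after the
    blue one. *)
Definition edge_bit (c : bool) (i j : nat) : bool :=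
  nth false w (n.+1 + c * (n * n) + (i * n + j)).

Definition list_bit (j k : nat) : bool :=
  nth false w (n.+1 + 2 * (n * n) + (j * m + k)).

Local Notation domains := (nat -> {set L}).

(** The whole row is filtered by the value of [E i] before the row, the one held in the control; at
    a loop [E i] itself shrinks meanwhile. *)
Definition revise (c : bool) (i : nat) (E : domains) : domains :=
  fun j => if edge_bit c i j then E j :&: nbhd c (E i) else E j.

Definition revise_rows (c : bool) (i : nat) (E : domains) : domains :=
  iteri i (revise c) E.

Definition apply_lists (E : domains) : domains :=
  fun j => [set a in E j | (idx a < m) ==> list_bit j (idx a)].

Definition round (E : domains) : domains :=
  apply_lists (revise_rows true n (revise_rows false n E)).

Definition shrunk (E E' : domains) : Prop := forall j, E' j \subset E j.

Definition changed (E E' : domains) : bool :=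
  has (fun j => E' j != E j) (iota 0 n).

Lemma shrunk_trans E1 E2 E3 : shrunk E1 E2 -> shrunk E2 E3 -> shrunk E1 E3.
Proof. by move=> h1 h2 j; apply: subset_trans (h1 j). Qed.

Lemma revise_shrunk c i E : shrunk E (revise c i E).
Proof. by move=> j; rewrite /revise; case: ifP => // _; exact: subsetIl. Qed.

Lemma revise_rows_shrunk c i E : shrunk E (revise_rows c i E).
Proof.
elim: i => [|i IHi] //=; exact: shrunk_trans IHi (@revise_shrunk c i _).
Qed.

Lemma apply_lists_shrunk E : shrunk E (apply_lists E).
Proof. by move=> j; apply/subsetP => a; rewrite inE => /andP[]. Qed.

Lemma round_shrunk E : shrunk E (round E).
Proof.
apply: shrunk_trans (@apply_lists_shrunk _).
exact: shrunk_trans (@revise_rows_shrunk _ _ _) (@revise_rows_shrunk _ _ _).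
Qed.

(** Along a descending chain a lost label never returns, so change flags can be accumulated by
    disjunction. *)
Lemma neq_trans_set (A B C : {set L}) :
  B \subset A -> C \subset B -> (C != A) = (B != A) || (C != B).
Proof.
move=> BA CB; case: (eqVneq B A) => [-> //|BneA] /=.
by apply: contraNneq BneA => CA; rewrite eqEsubset BA -CA.
Qed.

Lemma changed_trans E1 E2 E3 : shrunk E1 E2 -> shrunk E2 E3 ->
  changed E1 E3 = changed E1 E2 || changed E2 E3.
Proof.
move=> h1 h2; rewrite /changed -has_predU; apply: eq_has => j /=.
exact: neq_trans_set.
Qed.

Definition cells (D E T P : domains) (d : nat -> bool) : nat -> store :=
  fun j => (D j, E j, T j, P j, d j).

Lemma size_edges (c : bool) i : i < n ->
  n.+1 + c * (n * n) + (i * n + n) <= size w.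
Proof. by rewrite size_wE; case: c => ?; nia. Qed.

(** Once the rows before [i] are read, the marker of cell [j] equals [c] exactly when [i <= j], so
    the first cell that qualifies is [i]. *)
Lemma fetch_sweep c ch i p D E T P : i < n -> 0 < p <= size w ->
  reach time
    (at_sweep (Fetch c ch None) p (cells D E T P (fun j => (j < i) (+) c)))
    (at_sweep (Revise c ch (E i)) p
       (cells D E T P (fun j => (j < i.+1) (+) c))).
Proof.
move=> lt_i_n hp.
pose st j := Fetch c ch (if j <= i then None else Some (E i)).
have := @sweep st (fun=> p) (cells D E T P (fun j => (j < i) (+) c))
         (cells D E T P (fun j => (j < i.+1) (+) c)) 1 (Revise c ch (E i)) false.
rewrite /st /= [n <= i]leqNgt lt_i_n /=.
apply=> // j jn.
have := @cell_step (st j) p (cells D E T P (fun j => (j < i) (+) c))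
         (cells D E T P (fun j => (j < i.+1) (+) c)) j (st j.+1) true false.
rewrite addn0; apply=> //.
by rewrite /delta /cells /st ltnS; case: (ltngtP j i) => [_|_|->] /=;
  case: (c).
Qed.

Lemma revise_sweep (c : bool) ch i D E T P d : i < n ->
  let p := n.+1 + c * (n * n) + i * n in
  reach time
    (at_sweep (Revise c ch (E i)) p (cells D E T P d))
    (at_sweep (Fetch c (ch || changed E (revise c i E)) None) (p + n)
       (cells D (revise c i E) T P d)).
Proof.
move=> lt_i_n p.
pose st k := Revise c
  (ch || has (fun j => revise c i E j != E j) (iota 0 k)) (E i).
have := @sweep st (fun k => p + k) (cells D E T P d)
         (cells D (revise c i E) T P d) 1
         (Fetch c (ch || changed E (revise c i E)) None) false.
have pn : p + n <= size w by rewrite -addnA size_edges.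
have -> : Revise c ch (E i) = st 0 by rewrite /st /= orbF.
rewrite /= addn0; apply=> // k kn.
have := @cell_step (st k) (p + k) (cells D E T P d)
  (cells D (revise c i E) T P d) k (st k.+1) true true.
rewrite addn1 -addnS; apply=> // [|_]; last first.
  by apply: leq_trans pn; rewrite leq_add2l.
rewrite /delta /cells /st /revise -[k.+1]addn1 iotaD has_cat /= orbF orbA.
by rewrite /edge_bit addnA.
Qed.

Lemma rows_sweep (c : bool) ch D E T P i : i <= n ->
  let p := n.+1 + c * (n * n) in
  reach (i * 2 * time)
    (at_sweep (Fetch c ch None) p (cells D E T P (fun=> c)))
    (at_sweep (Fetch c (ch || changed E (revise_rows c i E)) None) (p + i * n)
       (cells D (revise_rows c i E) T P (fun j => (j < i) (+) c))).
Proof.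
move=> + p; elim: i => [|i IHi] lt_i_n.
  rewrite addn0; have -> : changed E E = false.
    by apply/hasPn => j _; rewrite eqxx.
  rewrite orbF; exact: reach_refl.
rewrite [i.+1 * 2]mulSn mulnDl addnC; apply: reach_trans (IHi (ltnW lt_i_n)) _.
rewrite mulSn mul1n /revise_rows /= -/(revise_rows c i E).
rewrite (@changed_trans E (revise_rows c i E)
  (revise c i (revise_rows c i E))); last 2 first.
- exact: (@revise_rows_shrunk c i E).
- exact: (@revise_shrunk c i _).
rewrite orbA [i.+1 * n]mulSn [n + _]addnC addnA.
apply: reach_trans (@fetch_sweep _ _ i _ _ _ _ _ lt_i_n _) _.
  have := @size_edges c i lt_i_n; rewrite addnA => h.
  by rewrite (leq_trans _ h) ?leq_addr // andbT /p !addSn.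
exact: revise_sweep.
Qed.

Lemma at_cell_eq f' f g k :
  (forall j, k <= j < n -> f j = g j) -> at_cell f' f k = at_cell f' g k.
Proof.
move=> fg; congr pair; apply/eq_in_map => j; rewrite mem_iota => jk.
by rewrite fg //; lia.
Qed.

Lemma cell_stay q p (f' f g : nat -> store) k q' :
  k < n -> p < size w -> verdict (Forward q) = None ->
  delta q (f k) (nth false w p) = (q', g k, false, true) ->
  (forall j, k < j -> f j = g j) ->
  reach 1 (Forward q, at_input p, at_cell f' f k)
          (Forward q', at_input p.+1, at_cell f' g k).
Proof.
move=> kn pw vq dq fg.
apply: (reach_one (x0 := (head None (at_input p).2, MoveRight))
                  (x1 := (Some (inr (g k)), Stay))) => //.
- by rewrite head_at_cell // /trans head_at_inputT dq.
- by rewrite at_input_right //; apply: view_eq_refl.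
rewrite /at_cell /= -[n - k]prednK ?subn_gt0 //= ; split=> //= i.
congr (nth None (_ :: _) i); apply/eq_in_map => j.
by rewrite mem_iota => /andP[/fg ->].
Qed.

(** The intermediate state of a cell whose first [q] list bits have been read. *)
Definition apply_bits (q : nat) (E : domains) : domains :=
  fun j => [set a in E j | (idx a < minn q m) ==> list_bit j (idx a)].

Lemma apply_bits0 E j : apply_bits 0 E j = E j.
Proof. by apply/setP => a; rewrite inE min0n ltn0 andbT. Qed.

Lemma apply_bitsS q E j : q < m ->
  apply_bits q.+1 E j =
  [set a in apply_bits q E j | (idx a == q) ==> list_bit j q].
Proof.
move=> qm; apply/setP => a; rewrite !inE; case: (a \in E j) => //=.
rewrite (minn_idPl qm) (minn_idPl (ltnW qm)) ltnS.
by case: (ltngtP (idx a) q) => [_|_|->] /=; rewrite ?andbT.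
Qed.

Lemma apply_bits_lists E j : apply_bits m E j = apply_lists E j.
Proof. by apply/setP => a; rewrite !inE minnn. Qed.

Lemma list_cell_loop ch em k f' D E T P d q : k < n -> q <= m ->
  let p := n.+1 + 2 * (n * n) + k * m in
  let Eq j := if j == k then apply_bits q E j else E j in
  reach q
    (Forward (Lists ch em ord0), at_input p, at_cell f' (cells D E T P d) k)
    (Forward (Lists (ch || (Eq k != E k)) em (inord q)), at_input (p + q),
      at_cell f' (cells D Eq T P d) k).
Proof.
move=> kn + p; elim: q => [|q IHq] qm.
  have -> : inord 0 = ord0 :> 'I_m.+1 by apply: val_inj; rewrite /= inordK.
  rewrite /= eqxx apply_bits0 eqxx orbF addn0.
  have -> : at_cell f'
      (cells D (fun j => if j == k then apply_bits 0 E j else E j) T P d) k =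
      at_cell f' (cells D E T P d) k.
    apply: at_cell_eq => j _; rewrite /cells.
    by case: eqP => // ->; rewrite apply_bits0.
  exact: reach_refl.
move=> Eq'; rewrite -[X in reach X]addn1; apply: reach_trans (IHq (ltnW qm)) _.
rewrite addnS; apply: cell_stay => // [||j kj].
- have : k * m + m <= n * m by rewrite -mulSnr leq_mul2r kn orbT.
  rewrite /p size_wE.
  by lia.
- rewrite /delta /cells inordK ?ltnS ?(ltnW qm) // qm /Eq' eqxx.
  rewrite (_ : [set a in _ | _] = apply_bits q.+1 E k); last first.
    by rewrite apply_bitsS // /list_bit addnA.
  rewrite -orbA -neq_trans_set //.
  + by apply/subsetP => a; rewrite inE => /andP[].
  + by rewrite apply_bitsS //; apply/subsetP => a; rewrite inE => /andP[].
- by rewrite /cells /Eq' (gtn_eqF kj).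
Qed.

Lemma lists_sweep ch em D E T P d :
  let E' := apply_lists E in let ch' := ch || changed E E' in
  let em' := em || has (fun j => E' j == set0) (iota 0 n) in
  reach time
    (at_sweep (Lists ch em ord0) (n.+1 + 2 * (n * n)) (cells D E T P d))
    (if ch' then at_sweep (Fetch false false None) n.+1 (cells D E' T P d)
     else at_sweep (Start em' false false) (size w) (cells D E' T P d)).
Proof.
move=> E' ch' em'; set p := n.+1 + 2 * (n * n).
pose st k := Lists (ch || has (fun j => E' j != E j) (iota 0 k))
  (em || has (fun j => E' j == set0) (iota 0 k)) ord0.
have := @sweep st (fun k => p + k * m) (cells D E T P d)
         (cells D E' T P d) m.+1
         (if ch' then Fetch false false None else Start em' false false) ch'.
have pn : p + n * m = size w by rewrite size_wE.
have -> : Lists ch em ord0 = st 0 by rewrite /st /= !orbF.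
rewrite /= mul0n addn0 pn.
move=> h; suff : reach time
    (at_sweep (st 0) p (cells D E T P d))
    (at_sweep (if ch' then Fetch false false None else Start em' false false)
      (if ch' then n.+1 else size w) (cells D E' T P d)) by case: (ch').
apply: h => // [k kn|]; last first.
  by rewrite -/(changed E E') -/ch'; case: (ch').
rewrite -[m.+1]addn1.
have := @list_cell_loop (ch || has (fun j => E' j != E j) (iota 0 k))
  (em || has (fun j => E' j == set0) (iota 0 k)) k (cells D E' T P d)
  D E T P d m kn (leqnn m).
move/reach_trans; apply; rewrite /= eqxx.
set f := cells D (fun j => if j == k then apply_bits m E j else E j) T P d.
have := @cell_step (Lists
  (ch || has (fun j => E' j != E j) (iota 0 k) || (apply_bits m E k != E k))
  (em || has (fun j => E' j == set0) (iota 0 k)) (inord m))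
  (p + k.+1 * m) f (cells D E' T P d) k (st k.+1) true false kn.
rewrite addn0 mulSn [m + _]addnC addnA.
rewrite -(@at_cell_eq _ f (cells D E T P d) k.+1); last first.
  by move=> j /andP[kj _]; rewrite /f /cells (gtn_eqF kj).
apply=> //; rewrite /delta /f /cells eqxx inordK // ltnn apply_bits_lists.
by rewrite /st -[k.+1]addn1 iotaD !has_cat /= !orbF !orbA.
Qed.

Lemma at_sweep_cells q p D E T P d E1 d1 :
  (forall j, j < n -> E j = E1 j /\ d j = d1 j) ->
  at_sweep q p (cells D E T P d) = at_sweep q p (cells D E1 T P d1).
Proof.
move=> h; congr pair; apply: at_cell_eq => j jn.
by rewrite /cells; have [-> ->] := h _ jn.
Qed.

Lemma fetch_none_sweep c ch p D E T P : 0 < p <= size w ->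
  let V q := at_sweep q p (cells D E T P (fun=> ~~ c)) in
  reach time (V (Fetch c ch None))
    (V (if c then Lists ch false ord0 else Fetch true ch None)).
Proof.
move=> hp V; apply: (@sweep (fun=> Fetch c ch None) (fun=> p)
  (cells D E T P (fun=> ~~ c)) _ 1
  (if c then Lists ch false ord0 else Fetch true ch None) false) => // [j jn|].
  have := @cell_step (Fetch c ch None) p (cells D E T P (fun=> ~~ c))
    (cells D E T P (fun=> ~~ c)) j (Fetch c ch None) true false jn.
  by rewrite addn0; apply=> //; case: (c).
by case: (c).
Qed.

Definition has_empty (E : domains) : bool :=
  has (fun j => E j == set0) (iota 0 n).

(** Each of the [2 * n] rows takes a [Fetch] and a [Revise] sweep; the other three are the two
    unsuccessful [Fetch] sweeps and the [Lists] sweep. *)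
Lemma round_sweeps D E T P :
  let f E := cells D E T P (fun=> false) in
  reach ((4 * n + 3) * time)
    (at_sweep (Fetch false false None) n.+1 (f E))
    (if changed E (round E) then
       at_sweep (Fetch false false None) n.+1 (f (round E))
     else at_sweep (Start (has_empty (round E)) false false) (size w)
       (f (round E))).
Proof.
move=> f; pose E1 := revise_rows false n E; pose E2 := revise_rows true n E1.
have -> : (4 * n + 3) * time =
    n * 2 * time + (time + (n * 2 * time + (time + time))) by lia.
have := @rows_sweep false false D E T P n (leqnn n).
rewrite mul0n addn0 -/E1 orFb => h; apply: reach_trans h _.
(* The blue rows leave all markers raised, which is how the red rows must find them. *)
rewrite (@at_sweep_cells _ _ D E1 T P _ E1 (fun=> true)); last first.
  by move=> j ->.
have h1 : n.+1 + n * n <= size w by rewrite size_wE; lia.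
apply: reach_trans; first exact: (@fetch_none_sweep false).
have := @rows_sweep true (changed E E1) D E1 T P n (leqnn n).
rewrite mul1n -/E2 => h; apply: reach_trans h _.
rewrite -addnA (_ : n * n + n * n = 2 * (n * n)); last by lia.
rewrite (@at_sweep_cells _ _ D E2 T P _ E2 (fun=> false)); last first.
  by move=> j ->.
have s1 : shrunk E E1 := @revise_rows_shrunk false n E.
have s2 : shrunk E1 E2 := @revise_rows_shrunk true n E1.
rewrite -(@changed_trans E E1 E2) //.
apply: reach_trans.
  by apply: (@fetch_none_sweep true); rewrite size_wE; lia.
have := @lists_sweep (changed E E2) false D E2 T P (fun=> false).
cbv zeta; rewrite -(@changed_trans E E2 (apply_lists E2)) //.
- exact: shrunk_trans s1 s2.
- exact: (@apply_lists_shrunk E2).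
Qed.

(** * Arc consistency *)

Definition arc_consistent (E : domains) : Prop :=
  (forall c i j, i < n -> j < n -> edge_bit c i j -> E j \subset nbhd c (E i)) /\
  (forall j a, j < n -> a \in E j -> idx a < m -> list_bit j (idx a)).

Definition csp_solution (g : nat -> L) : Prop :=
  (forall c i j, i < n -> j < n -> edge_bit c i j -> R c (g i) (g j)) /\
  (forall j, j < n -> idx (g j) < m -> list_bit j (idx (g j))).

Definition selects (g : nat -> L) (E : domains) : Prop :=
  forall j, j < n -> g j \in E j.

Definition weight (E : domains) : nat := \sum_(j < n) #|E j|.

Lemma weight_changed E E' : shrunk E E' -> changed E E' -> weight E' < weight E.
Proof.
move=> sE /hasP[j]; rewrite mem_iota => /= jn neq.
rewrite /weight (bigD1 (Ordinal jn)) //= [X in _ < X](bigD1 (Ordinal jn)) //=.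
rewrite -addSn leq_add //; last by apply: leq_sum => i _; apply: subset_leq_card.
by apply: proper_card; rewrite properEneq neq sE.
Qed.

Lemma unchanged E E' : changed E E' = false -> forall j, j < n -> E' j = E j.
Proof.
move=> /hasPn h j jn; apply/eqP; have := h j.
by rewrite mem_iota jn negbK => /(_ isT).
Qed.

(** Domains only shrink, so if the last equals the first, then all intermediate ones are equal to it
    and every single revision is without effect. *)
Lemma revise_rows_fixed c E :
  (forall j, j < n -> revise_rows c n E j = E j) ->
  forall i j, i < n -> j < n -> edge_bit c i j -> E j \subset nbhd c (E i).
Proof.
move=> fixE.
have mono i k : shrunk (revise_rows c i E) (revise_rows c (k + i) E).
  elim: k => [|k IHk]; first by move=> j.
  exact: shrunk_trans IHk (@revise_shrunk c (k + i) _).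
have fixi i j : i <= n -> j < n -> revise_rows c i E j = E j.
  move=> ile jn; apply/eqP; rewrite eqEsubset (revise_rows_shrunk c i E).
  by rewrite -{1}[E j]fixE // -(subnK ile); apply: mono.
move=> i j lt_i_n jn eij; have := fixi i.+1 j lt_i_n jn.
rewrite /revise_rows /= -/(revise_rows c i E) /revise eij !fixi ?(ltnW lt_i_n) //.
by move=> <-; apply: subsetIr.
Qed.

Lemma round_fixed E : changed E (round E) = false -> arc_consistent E.
Proof.
move=> /unchanged fixE; pose E1 := revise_rows false n E.
pose E2 := revise_rows true n E1.
have s1 : shrunk E E1 := @revise_rows_shrunk false n E.
have s2 : shrunk E1 E2 := @revise_rows_shrunk true n E1.
have s3 : shrunk E2 (round E) := @apply_lists_shrunk E2.
have f2 j : j < n -> E2 j = E j.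
  move=> jn; apply/eqP; rewrite eqEsubset (subset_trans (s2 j) (s1 j)).
  by rewrite -{1}[E j]fixE // s3.
have f1 j : j < n -> E1 j = E j.
  by move=> jn; apply/eqP; rewrite eqEsubset s1 -{1}f2 // s2.
split=> [[] i j lt_i_n jn|j a jn]; last first.
- by rewrite -{1}fixE // inE => /andP[_ /implyP h] /h.
- exact: revise_rows_fixed.
rewrite -!f1 //; apply: revise_rows_fixed => // k kn.
by rewrite [LHS]f2 // f1.
Qed.

Lemma round_selects g E : csp_solution g -> selects g E -> selects g (round E).
Proof.
move=> [gR gL] gE.
have rows c i F : i <= n -> selects g F -> selects g (revise_rows c i F).
  move=> + gF; elim: i => [//|i IHi] lt_i_n j jn.
  rewrite /revise_rows /= -/(revise_rows c i F) /revise; have h := IHi (ltnW lt_i_n).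
  case: ifP => eij; last exact: h.
  rewrite inE h //= inE; apply/existsP; exists (g i).
  by rewrite h //= gR.
move=> j jn; rewrite inE; apply/andP; split; last by apply/implyP; apply: gL.
exact: (rows true n _ (leqnn n) (rows false n _ (leqnn n) gE) j jn).
Qed.

(** Every round but the last lowers the weight, which bounds the number of rounds. *)
Lemma consistency_sweeps D E T P :
  exists E',
    [/\ reach ((weight E).+1 * (4 * n + 3) * time)
          (at_sweep (Fetch false false None) n.+1 (cells D E T P (fun=> false)))
          (at_sweep (Start (has_empty E') false false) (size w)
             (cells D E' T P (fun=> false))),
        shrunk E E', arc_consistent E'
      & forall g, csp_solution g -> selects g E -> selects g E'].
Proof.
have [k] := ubnP (weight E); elim: k E => // k IHk E; rewrite ltnS => wE.
have := @round_sweeps D E T P; case ch: changed => /= h.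
  have lt_w := weight_changed (@round_shrunk E) ch.
  have [|E' [r' sE' acE' selE']] := IHk (round E); first exact: leq_trans wE.
  exists E'; split=> //; first 1 last.
  - exact: shrunk_trans (@round_shrunk E) sE'.
  - by move=> g gs gE; apply: selE' => //; apply: round_selects.
  apply: reach_le (reach_trans h r'); rewrite -mulnDl -mulSn.
  by rewrite !leq_mul2r ltnS lt_w !orbT.
exists E; split=> //; last exact: round_fixed; last first.
have -> : has_empty E = has_empty (round E).
  apply: eq_in_has => j; rewrite mem_iota => /= jn.
  by rewrite (unchanged ch).
rewrite (@at_sweep_cells (Start (has_empty (round E)) false false)
  _ D E T P _ (round E) (fun=> false)); last first.
  by move=> j jn; rewrite (unchanged ch).
by apply: reach_le h; rewrite leq_mul2r leq_pmull ?orbT.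
Qed.

(** * Singleton arc consistency *)

Definition certified (D : domains) (u : nat) (a : L) : Prop :=
  exists E, [/\ shrunk D E, E u = [set a], arc_consistent E
              & forall j, j < n -> E j != set0].

Definition upd (D : domains) (u : nat) (X : {set L}) : domains :=
  fun j => if j == u then X else D j.

Section StartSweep.

Variables (f : bool) (p : nat) (D E T P : domains).
Hypothesis p_ok : 0 < p <= size w.

Let D1 : domains := fun j => if f then D j :\: P j else D j.
Let T1 : domains := fun j => if f then D1 j else T j.

Let st (pk : nat -> bool) (k : nat) :=
  Start f (pk k) (has (fun j => D1 j == set0) (iota 0 k)).

Lemma start_sweep_pick :
  (exists j, (j < n) && (T1 j != set0)) ->
  exists u a, [/\ u < n, a \in T1 u &
    reach time
      (at_sweep (Start f false false) p (cells D E T P (fun=> false)))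
      (at_sweep (Fetch false false None) n.+1
        (cells D1 (upd D1 u [set a]) (upd T1 u (T1 u :\ a))
           (upd (fun=> set0) u [set a]) (fun=> false)))].
Proof.
(* The sweep goes from left to right, so the label is picked in the least cell with a nonempty
   agenda. *)
move=> exT; case: (ex_minnP exT) => u /andP[un Tu] umin.
case pick_u: [pick a in T1 u] => [a|]; last first.
  by case: pickP pick_u Tu => // T0 _; case/set0Pn => a; rewrite T0.
have aT : a \in T1 u by case: pickP pick_u => // b bT [<-].
exists u, a; split=> //.
have := @sweep (st (fun k => u < k)) (fun=> p) (cells D E T P (fun=> false))
  (cells D1 (upd D1 u [set a]) (upd T1 u (T1 u :\ a))
           (upd (fun=> set0) u [set a]) (fun=> false)) 1 
  (Fetch false false None) true.
apply=> //; last by rewrite /st /= un.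
move=> j jn; have := @cell_step (st (fun k => u < k) j) p
  (cells D E T P (fun=> false))
  (cells D1 (upd D1 u [set a]) (upd T1 u (T1 u :\ a))
           (upd (fun=> set0) u [set a]) (fun=> false)) j
  (st (fun k => u < k) j.+1) true false jn.
rewrite addn0; apply=> //.
rewrite /delta /cells /st /upd -/(D1 j) -/(T1 j) -[in iota 0 j.+1]addn1 iotaD.
rewrite has_cat /= orbF ltnS; case: (ltngtP j u) => [ju|uj|->] //=.
- have Tj : T1 j == set0.
    by apply: contraTT ju => Tj; rewrite -leqNgt; apply: umin; rewrite jn.
  case: pickP => // b; by rewrite (eqP Tj) inE.
- by rewrite pick_u.
Qed.

Lemma start_sweep_stop :
  (forall j, j < n -> T1 j = set0) ->
  reach time
    (at_sweep (Start f false false) p (cells D E T P (fun=> false)))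
    (at_sweep (Halt (~~ has_empty D1)) p
      (cells D1 D1 T1 (fun=> set0) (fun=> false))).
Proof.
move=> T0; apply: (@sweep (st (fun=> false)) (fun=> p)
  (cells D E T P (fun=> false)) (cells D1 D1 T1 (fun=> set0) (fun=> false)) 1
  (Halt (~~ has_empty D1)) false) => //.
move=> j jn; have := @cell_step (st (fun=> false) j) p
  (cells D E T P (fun=> false))
  (cells D1 D1 T1 (fun=> set0) (fun=> false)) j
  (st (fun=> false) j.+1) true false jn.
rewrite addn0; apply=> //.
rewrite /delta /cells /st -/(D1 j) -/(T1 j) -[in iota 0 j.+1]addn1 iotaD.
rewrite has_cat /= orbF; case: pickP => // b.
by rewrite T0 // inE.
Qed.

End StartSweep.

Lemma weight_le E : weight E <= n * #|L|.
Proof.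
rewrite /weight -[n in n * _]card_ord -sum_nat_const.
by apply: leq_sum => i _; apply: max_card.
Qed.

Lemma weight_upd (E : domains) u (X : {set L}) :
  u < n -> X \proper E u -> weight (upd E u X) < weight E.
Proof.
move=> un XE; apply: weight_changed => [j|].
  by rewrite /upd; case: eqP => // ->; apply: proper_sub.
apply/hasP; exists u; first by rewrite mem_iota.
by rewrite /upd eqxx; move: XE; rewrite properEneq => /andP[].
Qed.

Lemma weight_eq (E E' : domains) :
  (forall j, j < n -> E j = E' j) -> weight E = weight E'.
Proof. by move=> h; apply: eq_bigr => j _; rewrite h. Qed.

(** Counted in sweeps: at most [(n * #|L|).+1] rounds and the [Start] sweep before them. *)
Definition probe_cost : nat := (n * #|L|).+1 * (4 * n + 3) + 1.

(* [D1] and [T1] are the domains and agenda once a failed probe has been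
   processed; a deletion refills the agenda, hence the lexicographic weight. *)
Lemma main_loop k f p D E T P : 0 < p <= size w ->
  let D1 := fun j => if f then D j :\: P j else D j in
  let T1 := fun j => if f then D1 j else T j in
  weight D1 * (n * #|L|).+1 + weight T1 < k ->
  shrunk D1 T1 ->
  (forall g, csp_solution g -> selects g D1) ->
  (forall u a, u < n -> a \in D1 u -> a \notin T1 u -> certified D1 u a) ->
  exists b v0 v1,
    [/\ reach (k * probe_cost * time)
          (at_sweep (Start f false false) p (cells D E T P (fun=> false)))
          (Forward (Halt b), v0, v1),
        b -> exists D', (forall j, j < n -> D' j != set0) /\
               (forall u a, u < n -> a \in D' u -> certified D' u a)
      & (exists g, csp_solution g) -> b].
Proof.
elim: k f p D E T P => // k IHk f p D E T P p_ok D1 T1; rewrite ltnS.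
move=> wk sT solD cert.
case exT: (has (fun j => T1 j != set0) (iota 0 n)); last first.
  have T0 j : j < n -> T1 j = set0.
    move=> jn; apply/eqP/negPn; move/hasPn: exT => /(_ j).
    by rewrite mem_iota => /(_ jn).
  exists (~~ has_empty D1), (at_input p),
    (at_cell (cells D1 D1 T1 (fun=> set0) (fun=> false))
             (cells D1 D1 T1 (fun=> set0) (fun=> false)) 0); split.
  - apply: reach_le (@start_sweep_stop f p D E T P p_ok T0).
    by rewrite leq_pmull // muln_gt0 /probe_cost addn1.
  - move=> nempty; exists D1; split=> [j jn|u a un aD].
      by move/hasPn: nempty => /(_ j); rewrite mem_iota => /(_ jn).
    by apply: cert; rewrite // T0 // inE.
  - case=> g /solD gD; apply/hasPn => j; rewrite mem_iota => /= jn.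
    by apply/set0Pn; exists (g j); apply: gD.
have [|u [a [un aT r1]]] := @start_sweep_pick f p D E T P p_ok.
  by move/hasP: exT => [j]; rewrite mem_iota => /= jn Tj; exists j; rewrite jn.
rewrite -/D1 -/T1 in aT r1.
have aD : a \in D1 u by apply: subsetP aT; apply: sT.
set E1 := upd D1 u [set a] in r1; set T2 := upd T1 u (T1 u :\ a) in r1.
set P2 := upd (fun=> set0) u [set a] in r1.
have [E2 [r2 sE2 acE2 selE2]] := @consistency_sweeps D1 E1 T2 P2.
have sE1 : shrunk D1 E1.
  by move=> j; rewrite /E1 /upd; case: eqP => // ->; rewrite sub1set.
have sD1E2 := shrunk_trans sE1 sE2.
have wT : weight T2 < weight T1.
  by apply: weight_upd; rewrite // properD1.
have r12 := reach_trans r1 r2.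
have cost : time + (weight E1).+1 * (4 * n + 3) * time <= probe_cost * time.
  rewrite -mulSn leq_mul2r /probe_cost addn1 ltnS leq_mul2r ltnS weight_le.
  by rewrite !orbT.
have size_ok : 0 < size w <= size w by rewrite leqnn andbT (leq_trans _ size_w).
have finish (K : exists b v0 v1,
    [/\ reach (k * probe_cost * time)
          (at_sweep (Start (has_empty E2) false false) (size w)
             (cells D1 E2 T2 P2 (fun=> false)))
          (Forward (Halt b), v0, v1),
        b -> exists D', (forall j, j < n -> D' j != set0) /\
               (forall u a, u < n -> a \in D' u -> certified D' u a)
      & (exists g, csp_solution g) -> b]) :
  exists b v0 v1,
    [/\ reach (k.+1 * probe_cost * time)
          (at_sweep (Start f false false) p (cells D E T P (fun=> false)))
          (Forward (Halt b), v0, v1),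
        b -> exists D', (forall j, j < n -> D' j != set0) /\
               (forall u a, u < n -> a \in D' u -> certified D' u a)
      & (exists g, csp_solution g) -> b].
  have [b [v0 [v1 [r3 hb hs]]]] := K; exists b, v0, v1; split=> //.
  apply: reach_le (reach_trans r12 r3).
  by rewrite [k.+1 * _]mulSn mulnDl leq_add2r.
apply: finish; clear r1 r2 r12.
(* A failed probe deletes [a], which lowers the weight of the domains; a successful one removes [a]
   from the agenda only, with [E2] as its certificate. *)
case emp: (has_empty E2); apply: IHk => //=.
- have wD : weight (fun j => D1 j :\: P2 j) < weight D1.
    rewrite (@weight_eq _ (upd D1 u (D1 u :\ a))); last first.
      by move=> j jn; rewrite /P2 /upd; case: eqP => [->|_]; rewrite ?setD0.
    by apply: weight_upd; rewrite // properD1.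
  apply: leq_trans wk; have := weight_le (fun j => D1 j :\: P2 j).
  move: wD; clear; move: (weight _) (weight D1) (weight T1) (n * _) => x y t M.
  by nia.
(* A solution that uses the deleted label would have survived the probe and kept all domains
   nonempty. *)
- move=> g gs j jn; rewrite inE solD // andbT /P2 /upd.
  case: eqP => [ju|_]; last by rewrite inE.
  rewrite inE; apply: contraTneq emp => gj.
  have gE : selects g E1.
    move=> i lt_i_n; rewrite /E1 /upd; case: eqP => [iu|_]; last exact: solD.
    by rewrite inE iu -ju gj.
  apply/hasPn => i; rewrite mem_iota => /= lt_i_n.
  by apply/set0Pn; exists (g i); apply: selE2.
(* Old certificates need not lie inside the smaller domains, but the agenda is full again and
   nothing is claimed. *)
- by move=> v b vn ->.
- by apply: leq_trans wk; rewrite ltn_add2l.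
- move=> j; rewrite /T2 /upd; case: eqP => // ->.
  by apply: subset_trans (sT u); rewrite subD1set.
move=> v b vn bD; rewrite /T2 /upd.
case: (eqVneq v u) => [vu|_]; last exact: cert.
rewrite !inE negb_and negbK => /orP[/eqP ba|]; last by rewrite -vu; apply: cert.
have ne j : j < n -> E2 j != set0.
  by move=> jn; move/hasPn: emp => /(_ j); rewrite mem_iota => /(_ jn).
exists E2; split=> //; apply/eqP; rewrite vu ba eqEsubset.
have E2u : E2 u \subset [set a] by have := sE2 u; rewrite /E1 /upd eqxx.
rewrite E2u sub1set; have /set0Pn[c cE] := ne u un.
by have := subsetP E2u c cE; rewrite inE => /eqP <-.
Qed.

(** * Initialisation and the polynomial bound *)

Let fresh : nat -> store := cells (fun=> setT) (fun=> set0) (fun=> set0)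
  (fun=> set0) (fun=> false).

Lemma setup_loop k : k <= n ->
  reach k (Setup, at_input 0, ([::], [::]))
    (Setup, at_input k, (rev [seq Some (inr (fresh i)) | i <- iota 0 k], [::])).
Proof.
elim: k => [|k IHk] kn; first exact: reach_refl.
rewrite -[X in reach X]addn1; apply: reach_trans (IHk (ltnW kn)) _.
have kw : k < size w by apply: ltn_trans size_w.
apply: (reach_one (x0 := (head None (at_input k).2, MoveRight))
                  (x1 := (Some (inr (fresh k)), MoveRight))) => //.
- by rewrite head_at_input // w_prefix ?kn // ltnW.
- by rewrite at_input_right //; apply: view_eq_refl.
- by rewrite rev_cells; apply: view_eq_refl.
Qed.

Lemma setup_sweep :
  reach time (Setup, at_input 0, ([::], [::]))
    (at_sweep (Start true false false) n.+1 fresh).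
Proof.
apply: (@reach_le (n + (1 + n.+1))).
  by rewrite /time; move: size_w; clear; move: (size w) => s; nia.
apply: reach_trans (setup_loop (leqnn n)) _.
apply: reach_trans (@back_home _ _ _).
apply: (reach_one (x0 := (head None (at_input n).2, MoveRight))
                  (x1 := (head None (at_cell fresh fresh n).2, MoveLeft))) => //.
- by rewrite head_at_input // w_prefix // ltnn /at_cell subnn.
- by rewrite at_input_right //; apply: view_eq_refl.
- have <- : at_cell fresh fresh n =
            (rev [seq Some (inr (fresh i)) | i <- iota 0 n], [::]).
    by rewrite /at_cell subnn.
  exact: at_cell_left.
Qed.

Lemma shows_init :
  cshows (tm_init sac_machine w) (Setup, at_input 0, ([::], [::])).
Proof.
split=> //=; rewrite ffunE /= /at_input /shows ?take0 ?drop0; split=> //= i.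
- by rewrite -/word; case: word => //; case: i => [|[|i]].
- by case: i => [|[|i]].
Qed.

Definition time_coefficient : nat := 12 * (m + 9) * #|L|.+1 ^ 3.

(** As [n < size w], there are quadratically many probes, each of quadratically many sweeps of
    linear length, which gives the exponent 5. *)
Lemma time_bound :
  time + (n * #|L|).+1 ^ 2 * probe_cost * time <= time_coefficient * size w ^ 5.
Proof.
rewrite /time /probe_cost /time_coefficient.
move: size_w; clear; move: (size w) #|L| => s l ns.
have N1 : (n * l).+1 <= l.+1 * s by nia.
have p1 : (n * l).+1 * (4 * n + 3) + 1 <= 5 * l.+1 * s ^ 2.
  apply: (@leq_trans (l.+1 * s * (4 * s) + 1)).
    by rewrite leq_add2r leq_mul //; lia.
  by rewrite expnS expn1; nia.
have k1 : (n * l).+1 ^ 2 <= l.+1 ^ 2 * s ^ 2 by rewrite -expnMn leq_exp2r.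
have t1 : (m + 9) * s.+1 <= 2 * (m + 9) * s by nia.
rewrite -mulSn; apply: (@leq_trans ((6 * l.+1 ^ 3 * s ^ 4) * (2 * (m + 9) * s))).
  apply: leq_mul => //.
  apply: (@leq_trans (l.+1 ^ 2 * s ^ 2 * (5 * l.+1 * s ^ 2)).+1).
    by rewrite ltnS leq_mul.
  rewrite (_ : _ * (5 * _ * _) = 5 * (l.+1 ^ 3 * s ^ 4)); last by ring.
  rewrite -mulnA [6 * _]mulSn -addn1 addnC leq_add2r muln_gt0 !expn_gt0 /=.
  by rewrite (leq_trans _ ns).
by apply: eq_leq; ring.
Qed.

Lemma sac_machine_correct :
  exists b : bool,
    [/\ tm_outputs sac_machine w
          (time_coefficient * size w ^ 5 + time_coefficient) b,
        b -> exists D, (forall j, j < n -> D j != set0) /\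
               (forall u a, u < n -> a \in D u -> certified D u a)
      & (exists g, csp_solution g) -> b].
Proof.
(* With [M = n * #|L|], the lexicographic weight is at most [M * M.+1 + M], which is less than
   [M.+1 ^ 2]. *)
have [|||||b [v0 [v1 [r hb hs]]]] := @main_loop ((n * #|L|).+1 ^ 2) true n.+1
  (fun=> setT) (fun=> set0) (fun=> set0) (fun=> set0).
- by rewrite size_w.
- set X := fun _ => _; have := weight_le X; move: (weight X) (n * #|L|) => x M.
  by rewrite expnS expn1; nia.
- by move=> j.
- by move=> g _ j _; rewrite /= !inE.
- by move=> u a _ /= ->.
exists b; split=> //.
have [k kt [hk _ _]] := reach_trans setup_sweep r shows_init.
have {}kt : k <= time_coefficient * size w ^ 5 + time_coefficient.
  by apply: leq_trans kt _; apply: leq_trans time_bound _; rewrite leq_addr.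
rewrite /tm_outputs -(subnK kt) iterD.
elim: (_ - k) => [|t IHt]; first by rewrite /= hk.
rewrite iterS; case: (iter t _ _) IHt => q ts /= vq.
by rewrite vq.
Qed.

End Machine.

(** * Potentials modulo two *)

Lemma connect_invariant (T : finType) (e : rel T) (P : T -> Prop) x y :
  (forall z t, e z t -> P z -> P t) -> connect e x y -> P x -> P y.
Proof.
move=> eP /connectP[p + ->]; elim: p x => //= z p IHp x /andP[exz pz] Px.
by apply: IHp pz _; apply: eP Px.
Qed.

Section Potential.

Variables (N : finType) (link : N -> N -> bool -> bool).
Hypothesis link_sym : forall x y c, link x y c = link y x c.

(** The signed double cover: a path from [(x, false)] to [(x, true)] is a closed walk through [x]
    whose signs add up to [true]. *)
Definition cover_edge : rel (N * bool) :=
  fun p q => link p.1 q.1 (p.2 (+) q.2).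

(** [rho y] is the sheet over [y] that is reached from the lower sheet over the root of its
    component. Balance makes this sheet unique, and a link of sign [c] changes it by [c]. *)
Lemma potential :
  (forall x, ~~ connect cover_edge (x, false) (x, true)) ->
  exists rho : N -> bool, forall x y c, link x y c -> rho y = rho x (+) c.
Proof.
move=> balanced.
pose base : rel N := fun x y => link x y false || link x y true.
have base_sym : connect_sym base.
  by apply: sym_connect_sym => x y; rewrite /base link_sym (link_sym x y true).
have cover_sym : connect_sym cover_edge.
  by apply: sym_connect_sym => p q; rewrite /cover_edge link_sym addbC.
(* Exchanging the two sheets is an automorphism of the cover. *)
have flip x s y t : connect cover_edge (x, s) (y, t) ->
    connect cover_edge (x, ~~ s) (y, ~~ t).
  move=> st; apply: (@connect_invariant _ _
    (fun q => connect cover_edge (x, ~~ s) (q.1, ~~ q.2)) _ (y, t) _ st) => //=.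
  move=> p q epq h; apply: connect_trans h (connect1 _).
  by rewrite /cover_edge /= addNb addbN negbK.
have lift x y : connect base x y ->
    exists t, connect cover_edge (x, false) (y, t).
  move=> xy; apply: (@connect_invariant _ _
    (fun z => exists t, connect cover_edge (x, false) (z, t)) _ y _ xy).
    move=> z z' /orP ezz' [t h].
    case: ezz' => ezz'; [exists t | exists (~~ t)];
      apply: connect_trans h (connect1 _).
      by rewrite /cover_edge /= addbb.
    by rewrite /cover_edge /= addbN addbb.
  by exists false.
pose rho y := connect cover_edge (root base y, false) (y, true).
have rhoP y : connect cover_edge (root base y, false) (y, rho y).
  case h: (rho y) => //; have [|[] //] := lift (root base y) y.
    by rewrite base_sym connect_root.
  by rewrite -/(rho y) h.
exists rho => x y c exy; have := rhoP y.
have <- : root base x = root base y.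
  apply/(rootP base_sym)/connect1.
  by case: c exy; rewrite /base => ->; rewrite ?orbT.
have : connect cover_edge (root base x, false) (y, rho x (+) c).
  apply: connect_trans (rhoP x) (connect1 _).
  by rewrite /cover_edge /= addKb.
have anti s : connect cover_edge (y, s) (y, ~~ s) = false.
  by case: s; first rewrite cover_sym; apply: negPf; apply: balanced.
move=> h1 h2; apply/eqP; apply: contraFT (anti (rho y)).
rewrite cover_sym in h2; have := connect_trans h2 h1.
by case: (rho y); case: (_ (+) _).
Qed.

End Potential.

(** * Solutions from singleton arc consistent domains *)

Section Consistency.

Variables (L I : finType) (R : bool -> rel L) (G : bool -> rel I).

Definition supported (E : I -> {set L}) : Prop :=
  forall c x y b, G c x y -> b \in E y -> exists2 a, a \in E x & R c a b.

Definition singleton_consistent (D : I -> {set L}) : Prop :=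
  forall u a, a \in D u -> exists E : I -> {set L},
    [/\ forall v, E v \subset D v, E u = [set a], supported E
      & forall v, E v != set0].

(* A closed walk of sign [true] would force a label, inside its own certificate,
   to have two different values. *)
Lemma sac_potential (N : finType) (link : N -> N -> bool -> bool)
    (at_vertex : N -> I) (value : N -> L -> bool) (D : I -> {set L}) :
  (forall v, D v != set0) -> singleton_consistent D ->
  (forall x y c, link x y c = link y x c) ->
  (forall E : I -> {set L}, (forall v, E v \subset D v) -> supported E ->
    forall x y c t, link x y c ->
      (forall a, a \in E (at_vertex x) -> value x a = t) ->
      forall b, b \in E (at_vertex y) -> value y b = t (+) c) ->
  exists rho : N -> bool, forall x y c, link x y c -> rho y = rho x (+) c.
Proof.
move=> D0 sacD link_sym linkP; apply: potential => // x.
have /set0Pn[a aD] := D0 (at_vertex x).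
have [E [sED Ex suppE _]] := sacD _ _ aD.
(* Invariant along a walk in the cover: over [(y, s)], all labels of the certificate have the value
   of [a] at [x] changed by [s]. *)
apply/negP => /(@connect_invariant _ _ (fun q => forall b,
  b \in E (at_vertex q.1) -> value q.1 b = value x a (+) q.2)) h.
have {h} := h _ _ a; rewrite /= Ex set11 => h.
suff: value x a = value x a (+) true by rewrite addbT; case: (value x a).
apply: h => // [p q epq Pp b bE|b]; last by rewrite inE addbF => /eqP ->.
by rewrite (linkP E sED suppE _ _ _ _ epq Pp b bE) -addbA addKb.
Qed.

End Consistency.

(** Only the vertex of a label has to survive, with some sign: lists do not restrict signs, and a
    potential may choose other ones. *)
Definition sac_decides (W : finType) (R : bool -> rel (W * bool)) : Prop :=
  forall (I : finType) (G : bool -> rel I) (D : I -> {set W * bool}),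
    (forall c, symmetric (G c)) -> (forall v, D v != set0) ->
    singleton_consistent R G D ->
    exists g : I -> W * bool, (forall v, exists s, ((g v).1, s) \in D v) /\
      (forall c x y, G c x y -> R c (g x) (g y)).

(** The certificate of one label at the root of a component fixes a side at every vertex there, and
    hence a bipartition [p]. Domains cut down to [p] remain singleton consistent, because a
    certificate that starts on the right side stays on it. *)
Lemma sac_decides_sided (W : finType) (R : bool -> rel (W * bool))
    (side : W -> bool) :
  (forall c a b, R c a b -> side b.1 = ~~ side a.1) ->
  (forall (I : finType) (G : bool -> rel I) (D : I -> {set W * bool})
      (p : I -> bool),
    (forall c, symmetric (G c)) -> (forall v, D v != set0) ->
    singleton_consistent R G D ->
    (forall v a, a \in D v -> side a.1 = p v) ->
    (forall c x y, G c x y -> p y = ~~ p x) ->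
    exists g : I -> W * bool, (forall v, exists s, ((g v).1, s) \in D v) /\
      (forall c x y, G c x y -> R c (g x) (g y))) ->
  sac_decides R.
Proof.
move=> sideR sided I G D symG D0 sacD.
pose e : rel I := fun x y => G false x y || G true x y.
have eG c x y : G c x y -> e x y by rewrite /e; case: c => ->; rewrite ?orbT.
have Ge x y : e x y -> exists c, G c x y.
  by case/orP; [exists false | exists true].
have e_sym : connect_sym e.
  by apply: sym_connect_sym => x y; rewrite /e symG (symG true).
have spread (E : I -> {set W * bool}) u v (q : I -> bool) :
    supported R G E -> connect e u v ->
    (forall x y, e x y -> q y = ~~ q x) ->
    (forall b, b \in E u -> side b.1 = q u) ->
    forall b, b \in E v -> side b.1 = q v.
  move=> suppE uv qe; apply: (@connect_invariant _ e
    (fun z => forall b, b \in E z -> side b.1 = q z)) uv.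
  move=> x y exy h b bE; have [c Gxy] := Ge _ _ exy.
  have [a aE /sideR ->] := suppE _ _ _ _ Gxy bE.
  by rewrite h // (qe _ _ exy).
have uniform (E : I -> {set W * bool}) u v :
    supported R G E -> (forall v, E v != set0) -> connect e u v ->
    (exists a, E u = [set a]) ->
    exists s, forall b, b \in E v -> side b.1 = s.
  move=> suppE E0 uv [a Eu]; apply: (@connect_invariant _ e
    (fun z => exists s, forall b, b \in E z -> side b.1 = s)) uv _.
    move=> x y exy [s h]; exists (~~ s) => b bE; have [c Gxy] := Ge _ _ exy.
    by have [a' aE /sideR ->] := suppE _ _ _ _ Gxy bE; rewrite h.
  by exists (side a.1) => b; rewrite Eu inE => /eqP ->.
have [a0 a0D] := fin_all_exists (fun v => elimT (set0Pn _) (D0 v)).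
have [F FP] := fin_all_exists (fun u => sacD u (a0 u) (a0D u)).
have [p pP] : exists p : I -> bool, forall v b,
    b \in F (root e v) v -> side b.1 = p v.
  apply: (@fin_all_exists _ _ (fun v q => forall b, b \in F (root e v) v ->
    side b.1 = q)) => v.
  have [sF Fu suppF F0] := FP (root e v).
  apply: (uniform _ (root e v)) => //; last by exists (a0 (root e v)).
  by rewrite e_sym connect_root.
have pe x y : e x y -> p y = ~~ p x.
  move=> exy; have [c Gxy] := Ge _ _ exy.
  have [sF Fu suppF F0] := FP (root e y).
  have /set0Pn[b bF] := F0 y; have [a aF ab] := suppF _ _ _ _ Gxy bF.
  rewrite -(pP _ _ bF) (sideR _ _ _ ab) (pP x) //.
  by have /(rootP e_sym) -> := connect1 exy.
pose D' v := [set a in D v | side a.1 == p v].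
have D'D v : D' v \subset D v by apply/subsetP => a; rewrite inE => /andP[].
have D'0 v : D' v != set0.
  have [sF Fu suppF F0] := FP (root e v); have /set0Pn[b bF] := F0 v.
  by apply/set0Pn; exists b; rewrite inE (subsetP (sF v)) //= (pP _ _ bF).
have supp' : supported R G D'.
  move=> c x y b Gxy; rewrite inE => /andP[bD sb].
  have [E [sE Ey suppE E0]] := sacD _ _ bD.
  have [|a aE ab] := suppE _ _ _ b Gxy; first by rewrite Ey set11.
  exists a => //; rewrite inE (subsetP (sE x)) //=.
  by rewrite (sideR _ _ _ ab) (pe _ _ (eG _ _ _ Gxy)) (inj_eq negb_inj) in sb.
have [|v a|c x y|g [gD gR]] := sided I G D' p symG D'0; first last.
- exists g; split=> // v; have [s h] := gD v; exists s.
  exact: subsetP (D'D v) _ h.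
- by move/eG/pe.
- by rewrite inE => /andP[_ /eqP].
move=> u a; rewrite inE => /andP[aD sa].
have [E [sE Eu suppE E0]] := sacD _ _ aD.
have sideE v : connect e u v -> forall b, b \in E v -> side b.1 = p v.
  move=> uv; apply: spread uv pe _ => // b.
  by rewrite Eu inE => /eqP ->; apply/eqP.
(* The side of [E] is known only on the component of [u]; elsewhere the cut domains support
   themselves. *)
exists (fun v => if connect e u v then E v else D' v); split.
- move=> v; case: ifP => // uv; apply/subsetP => b bE.
  by rewrite inE (subsetP (sE v)) //= (sideE _ uv).
- by rewrite connect0.
- move=> c x y b Gxy; have exy := eG _ _ _ Gxy.
  rewrite -(same_connect1r e_sym exy); case: ifP => _; first exact: suppE.
  exact: supp'.
- by move=> v; case: ifP.
Qed.

(** * Ordered targets *)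

(** With [true] for red, [c (+) a.2 (+) b.2] is the colour of the edge after switching at the
    endpoints whose second component is [true]. *)
Definition label_rel (W : finType) (H : signed_graph W) (c : bool) :
    rel (W * bool) :=
  fun a b => if c (+) a.2 (+) b.2 then red H a.1 b.1 else blue H a.1 b.1.

(** Red edges are here the bicoloured ones. If a supported pair of labels used a red edge, then by
    [lower_red] the least vertices would also span one. So wherever the least vertices span a
    unicoloured edge, the signs of supported pairs differ by exactly the colour, and these edges are
    the links. *)
Lemma sac_decides_ordered (W : finType) (H : signed_graph W)
    (side : W -> bool) (rank : W -> nat) :
  (forall x y, blue H x y -> side y = ~~ side x) ->
  (forall x y, red H x y -> blue H x y) ->
  (forall x y x' y', blue H x y -> blue H x' y' -> side x = side x' ->
    rank x <= rank x' -> rank y' <= rank y -> blue H x y') ->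
  (forall x y x' y', blue H x y -> red H x' y' -> side x = side x' ->
    rank x <= rank x' -> rank y <= rank y' -> red H x y) ->
  sac_decides (label_rel H).
Proof.
move=> sideH redblue min_edge lower_red.
have Rblue c a b : label_rel H c a b -> blue H a.1 b.1.
  by rewrite /label_rel; case: ifP => _ // /redblue.
apply: (sac_decides_sided (side := side)) => [c a b /Rblue/sideH //|].
move=> I G D p symG D0 sacD sideD pG.
have [f0 f0P] : exists f0 : I -> W * bool, forall v,
    f0 v \in D v /\ forall a, a \in D v -> rank (f0 v).1 <= rank a.1.
  apply: (@fin_all_exists _ _ (fun v (b : W * bool) => b \in D v /\
    forall a, a \in D v -> rank b.1 <= rank a.1)) => v.
  have /set0Pn[a0 a0D] := D0 v.
  by case: (arg_minnP (fun a => rank a.1) a0D) => a aD amin; exists a; split.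
pose f v := (f0 v).1.
have suppD : supported (label_rel H) G D.
  move=> c x y b Gxy bD; have [E [sE Ey suppE E0]] := sacD _ _ bD.
  have [|a aE ab] := suppE _ _ _ b Gxy; first by rewrite Ey set11.
  by exists a; rewrite // (subsetP (sE x)).
have f_edge c x y : G c x y -> blue H (f x) (f y).
  move=> Gxy; have [fxD fxmin] := f0P x; have [fyD fymin] := f0P y.
  have [a aD /Rblue ab] := suppD _ _ _ _ Gxy fyD.
  have [b bD /Rblue ba] := suppD c y x (f0 x) (etrans (symG c y x) Gxy) fxD.
  rewrite blue_sym in ba; apply: (min_edge _ b.1 a.1) => //.
  - by rewrite !(sideD x).
  - exact: fxmin.
  - exact: fymin.
have [|E sE suppE x y c t /andP[Gxy nred] Ex b bE|rho rhoP] :=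
  @sac_potential _ I (label_rel H) G I
    (fun x y c => G c x y && ~~ red H (f x) (f y)) id (fun _ a => a.2)
    D D0 sacD.
- by move=> x y c; rewrite symG red_sym.
- have [a aE ab] := suppE _ _ _ _ Gxy bE.
  have aD := subsetP (sE x) _ aE; have bD := subsetP (sE y) _ bE.
  move: ab; rewrite /label_rel (Ex a aE).
  have [fxD fxmin] := f0P x; have [fyD fymin] := f0P y.
  case: ifP => [_ rab|]; last by case: c {Gxy}; case: t {Ex}; case: (b.2).
  by rewrite (lower_red _ _ a.1 b.1) ?(f_edge c) ?fxmin ?fymin ?(sideD x) in nred.
exists (fun v => (f v, rho v)); split=> [v|c x y Gxy].
  by exists (f0 v).2; have [h _] := f0P v; rewrite /f /=; case: (f0 v) h.
rewrite /label_rel /=; case: ifP => [|_]; last exact: f_edge Gxy.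
case: (boolP (red H (f x) (f y))) => // nred; rewrite (rhoP x y c) ?Gxy //.
by case: c {Gxy}; case: (rho x).
Qed.

(** The 4-cycle is complete bipartite and has no red edge, so a constant rank is a min ordering. *)
Lemma sac_decides_H0 : sac_decides (label_rel H0).
Proof.
apply: (@sac_decides_ordered _ H0 (fun x => odd x) (fun=> 0)).
- by move=> [[|[|[|[|i]]]] hi] [[|[|[|[|j]]]] hj].
- by move=> [[|[|[|[|i]]]] hi] [[|[|[|[|j]]]] hj].
- by move=> [[|[|[|[|i]]]] hi] [[|[|[|[|j]]]] hj]
             [[|[|[|[|i']]]] hi'] [[|[|[|[|j']]]] hj'].
- by move=> x y [[|[|[|[|i']]]] hi'] [[|[|[|[|j']]]] hj'].
Qed.

Definition Hl_side (l : nat) (x : Hl_vertex l) : bool :=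
  match x with inl i => odd i | inr s => ~~ s end.

(** Even t_i come by increasing and odd t_i by decreasing index, with s_1 and s_2 last; so b and w
    are the least vertices of their sides. *)
Definition Hl_rank (l : nat) (x : Hl_vertex l) : nat :=
  match x with
  | inl i => if odd i then l - i else i
  | inr _ => l.+1
  end.

Lemma sac_decides_Hl (l : nat) : odd l -> sac_decides (label_rel (Hl l)).
Proof.
(* For [x] on the even and [y] on the odd side, adjacency becomes one inequality: the path edges and
   the bicoloured edges together are the pairs with [i <= j.+1]. *)
move=> odd_l; pose e (x y : Hl_vertex l) := match x, y with
  | inl i, inl j => i <= j.+1
  | inl i, inr _ => val i == 0
  | inr _, inl j => val j == l
  | inr _, inr _ => true
  end.
have blueE x y : blue (Hl l) x y =
    (Hl_side x != Hl_side y) && (if Hl_side x then e y x else e x y).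
{ case: x => [i|[]]; case: y => [j|[]]; rewrite /= /sym_closure //=.
  - have := ltn_ord i; have := ltn_ord j.
    case: (boolP (odd i)) => oi; case: (boolP (odd j)) => oj /=;
    by move=> *; apply/idP/idP; lia.
  all: try by have := ltn_ord i; case: (boolP (odd i)) => oi /= *;
    apply/idP/idP; lia.
  all: by have := ltn_ord j; case: (boolP (odd j)) => oj /= *;
    apply/idP/idP; lia. }
have e_min x y x' y' :
    ~~ Hl_side x -> ~~ Hl_side x' -> Hl_side y -> Hl_side y' ->
    e x y -> e x' y' -> Hl_rank x <= Hl_rank x' -> Hl_rank y' <= Hl_rank y ->
    e x y'.
  case: x => [i|[]] //=; case: x' => [i'|[]] //=;
  case: y => [j|[]] //=; case: y' => [j'|[]] //=;
  try (have := ltn_ord i); try (have := ltn_ord j);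
  try (have := ltn_ord i'); try (have := ltn_ord j');
  try (case: (boolP (odd i)) => //= ?); try (case: (boolP (odd i')) => //= ?);
  try (case: (boolP (odd j)) => //= ?); try (case: (boolP (odd j')) => //= ?);
  by lia.
apply: (@sac_decides_ordered _ (Hl l) (@Hl_side l) (@Hl_rank l)).
- by move=> x y; rewrite blueE => /andP[]; case: Hl_side; case: Hl_side.
- by move=> x y; rewrite /= /sym_closure => /orP[] ->; rewrite !orbT.
- move=> x y x' y'; rewrite !blueE => /andP[xy exy] /andP[x'y' ex'y'] xx' rx ry.
  rewrite -xx' in x'y' ex'y'; rewrite x'y'; move: exy ex'y' xy x'y'.
  case: (boolP (Hl_side x)) (xx') => sx /esym sx' exy ex'y' sy sy'.
    by apply: (e_min _ x' _ _ _ _ _ _ ex'y' exy ry rx);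
      move: sx' sy sy'; do 3!case: Hl_side.
  by apply: (e_min _ _ _ _ _ _ _ _ exy ex'y' rx ry);
    move: sx' sy sy'; do 3!case: Hl_side.
move=> x y x' y'; rewrite blueE /= /sym_closure => /andP[xy _].
move: xy; case: x => [i|[]] //=; case: x' => [i'|[]] //=;
  case: y => [j|[]] //=; case: y' => [j'|[]] //=;
  try (have := ltn_ord i); try (have := ltn_ord j);
  try (have := ltn_ord i'); try (have := ltn_ord j');
  try (case: (boolP (odd i)) => //= ?); try (case: (boolP (odd i')) => //= ?);
  try (case: (boolP (odd j)) => //= ?); try (case: (boolP (odd j')) => //= ?);
  by lia.
Qed.

(** * The target H_1 *)

(* The hubs are b and w, and the kind tells s_1, s_2 from t_1, t_2.  Between two
   vertices other than hubs, the edge relation says that both coordinates of the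
   labels differ by the colour of the edge; a hub has only one coordinate, its
   sign, and only constrains that one. *)
Definition H1_side (x : 'I_6) : bool := val x \in [:: 1; 3; 4].
Definition H1_hub (x : 'I_6) : bool := val x \in [:: 0; 3].
Definition H1_kind (x : 'I_6) : bool := val x \in [:: 4; 5].

(** On its own side a vertex adds its kind to the sign; the other coordinate is the sign alone. So
    the two coordinates differ by the kind. *)
Definition H1_coord (k : bool) (a : 'I_6 * bool) : bool :=
  a.2 (+) (H1_kind a.1 && (H1_side a.1 == k)).

(** Equation [k] is dropped when the endpoint that is not on side [k] is a hub, so a hub takes part
    only in the equation of its own side. *)
Definition H1_active (k : bool) (a b : 'I_6 * bool) : bool :=
  ~~ H1_hub (if H1_side a.1 == k then b.1 else a.1).

Lemma H1_relE c a b : label_rel H1 c a b =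
  (H1_side b.1 == ~~ H1_side a.1) &&
  [forall k, H1_active k a b ==> (H1_coord k b == H1_coord k a (+) c)].
Proof.
have forall_bool (P : pred bool) : [forall k, P k] = P false && P true.
  apply/forallP/andP => [h|[h1 h2] []] //; by split; apply: h.
rewrite forall_bool; case: a => x s; case: b => y t.
by case: x => [[|[|[|[|[|[|i]]]]]] hi] //; case: y => [[|[|[|[|[|[|j]]]]]] hj] //;
  case: s; case: t; case: c.
Qed.

Lemma sac_decides_H1 : sac_decides (label_rel H1).
Proof.
apply: (sac_decides_sided (side := H1_side)) => [c a b|].
  by rewrite H1_relE => /andP[/eqP].
move=> I G D p symG D0 sacD sideD pG.
pose inner v := [forall a in D v, ~~ H1_hub a.1].
have innerP v a : inner v -> a \in D v -> ~~ H1_hub a.1.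
  by move/forall_inP; apply.
(* A node is a vertex with one of its coordinates. Edges link equal coordinates as far as the
   equation is active; an inner vertex whose surviving labels all have kind [c] links its own two
   coordinates. *)
pose link (x y : I * bool) c :=
  [&& x.2 == y.2, G c x.1 y.1 & inner (if p x.1 == x.2 then y.1 else x.1)] ||
  [&& x.1 == y.1, x.2 != y.2, inner x.1
    & [forall a in D x.1, H1_kind a.1 == c]].
have link_sym x y c : link x y c = link y x c.
  case: x y => [x k] [y k']; rewrite /link /= symG; congr orb.
    rewrite [k == k']eq_sym; case: eqP => //= -> {k'}.
    by case: (boolP (G c y x)) => //= /pG ->; case: (p y); case: k.
  by rewrite eq_sym [k == k']eq_sym; case: eqP => // ->.
have [|rho rhoP] := @sac_potential _ _ _ _ _ link fst (fun x => H1_coord x.2)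
    D D0 sacD link_sym.
  move=> E sE suppE [x k] [y k'] c t /orP[/and3P[]|/and4P[]] /=.
    move=> /eqP <- Gxy inn Ex b bE.
    have [a aE] := suppE _ _ _ _ Gxy bE.
    rewrite H1_relE => /andP[_ /forallP/(_ k)].
    have aD := subsetP (sE x) _ aE; have bD := subsetP (sE y) _ bE.
    have -> : H1_active k a b.
      move: inn; rewrite /H1_active (sideD x) //.
      by case: ifP => _ inn; [apply: innerP inn bD | apply: innerP inn aD].
    by move=> /eqP ->; rewrite (Ex _ aE).
  move=> /eqP <- kk' inn /forall_inP kind_c Ex b bE.
  have bD := subsetP (sE x) _ bE.
  rewrite -(Ex b bE) -(eqP (kind_c _ bD)) /H1_coord -addbA; congr addb.
  by case: (H1_kind _); case: (H1_side _); case: k k' kk' {Ex} => [] [].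
pose kind v := rho (v, false) (+) rho (v, true).
pose vertex v : 'I_6 := if inner v
  then inord (if p v then (if kind v then 4 else 1)
              else (if kind v then 5 else 2))
  else inord (if p v then 3 else 0).
(* The sign of an inner vertex is its coordinate for the opposite side, that of a hub its only
   coordinate. *)
pose g v := (vertex v, rho (v, if inner v then ~~ p v else p v)).
have side_vertex v : H1_side (vertex v) = p v.
  rewrite /vertex /H1_side.
  by case: (inner v); case: (p v); case: (kind v); rewrite /= inordK.
have hub_vertex v : H1_hub (vertex v) = ~~ inner v.
  rewrite /vertex /H1_hub.
  by case: (inner v); case: (p v); case: (kind v); rewrite /= inordK.
have kind_vertex v : inner v -> H1_kind (vertex v) = kind v.
  rewrite /vertex /H1_kind => ->.
  by case: (p v); case: (kind v); rewrite /= inordK.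
have coord_g v k : inner v || (k == p v) -> H1_coord k (g v) = rho (v, k).
  rewrite /H1_coord /= side_vertex.
  case: (boolP (inner v)) => /= [inn _|ninn /eqP ->].
    rewrite kind_vertex // /kind; case: (p v) k => [] [] /=;
    rewrite ?andbF ?addbF ?andbT //=;
    by case: (rho (v, false)); case: (rho (v, true)).
  rewrite (_ : H1_kind _ = false) ?addbF //.
  by rewrite /vertex (negPf ninn) /H1_kind; case: (p v); rewrite /= inordK.
exists g; split=> [v|c x y Gxy]; last first.
  rewrite H1_relE /= !side_vertex (pG _ _ _ Gxy) eqxx; apply/forallP => k.
  apply/implyP; rewrite /H1_active /= side_vertex => act.
  have inn : inner (if p x == k then y else x).
    by move: act; case: ifP => _; rewrite hub_vertex negbK.
  rewrite !coord_g.
  - by rewrite (rhoP (x, k) (y, k) c) // /link /= eqxx Gxy inn.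
  - by move: inn; case: eqP => [->|_ -> //]; rewrite eqxx orbT.
  - move: inn; rewrite (pG _ _ _ Gxy); case: eqP => [_ -> //|/eqP].
    by case: (p x); case: (k) => //; rewrite orbT.
have side_hub (x y : 'I_6) :
    H1_side x = H1_side y -> H1_hub x -> H1_hub y -> x = y.
  by move: x y => [[|[|[|[|[|[|i]]]]]] hi] // [[|[|[|[|[|[|j]]]]]] hj] // *;
    apply: val_inj.
have side_kind (x y : 'I_6) : H1_side x = H1_side y -> ~~ H1_hub x ->
    ~~ H1_hub y -> H1_kind x = H1_kind y -> x = y.
  by move: x y => [[|[|[|[|[|[|i]]]]]] hi] // [[|[|[|[|[|[|j]]]]]] hj] // *;
    apply: val_inj.
suff [a aD va] : exists2 a, a \in D v & vertex v = a.1.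
  by exists a.2; rewrite /= va; case: a aD {va}.
case: (boolP (inner v)) => [inn|ninn]; last first.
  have /forall_inPn[a aD] := ninn; rewrite negbK => ha; exists a => //.
  by apply: side_hub; rewrite ?hub_vertex // side_vertex (sideD v).
have [/exists_inP[a aD /eqP ka]|/exists_inPn nk] :=
    boolP [exists a in D v, H1_kind a.1 == kind v].
  exists a => //; apply: side_kind; rewrite ?hub_vertex ?inn ?kind_vertex ?ka //.
    by rewrite side_vertex (sideD v).
  exact: innerP inn aD.
(* If no surviving label had the kind given by [rho], all would have the other kind, and the link at
   [v] would have forced that one. *)
have : link (v, false) (v, true) (~~ kind v).
  rewrite /link /= eqxx inn /=; apply/forall_inP => a /nk.
  by case: (H1_kind _); case: (kind v).
by move/rhoP; rewrite /kind; case: (rho (v, false)); case: (rho (v, true)).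
Qed.

(** * Switching *)

(** Renaming the target along [f] and switching it by [tau] only relabels: domains and certificates
    are mapped forward by [psi], and the solution is pulled back. *)
Lemma sac_decides_transfer (W W' : finType) (R : bool -> rel (W * bool))
    (R' : bool -> rel (W' * bool)) (f : W -> W') (tau : W -> bool) :
  injective f ->
  (forall c a b,
    R' c (f a.1, a.2 (+) tau a.1) (f b.1, b.2 (+) tau b.1) = R c a b) ->
  sac_decides R' -> sac_decides R.
Proof.
move=> f_inj; pose psi (a : W * bool) := (f a.1, a.2 (+) tau a.1).
move=> RR' dec I G D symG D0 sacD.
have psi_inj : injective psi.
  move=> [x s] [y t] [/f_inj -> /= h]; congr pair.
  by move: h; case: s; case: t; case: (tau y).
have [||g' [gD gR]] := dec I G (fun v => psi @: D v) symG.
- move=> v; have /set0Pn[a aD] := D0 v.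
  by apply/set0Pn; exists (psi a); apply: imset_f.
- move=> u _ /imsetP[a aD ->]; have [E [sE Eu suppE E0]] := sacD _ _ aD.
  exists (fun v => psi @: E v); split.
  + by move=> v; apply: imsetS.
  + by rewrite Eu imset_set1.
  + move=> c x y _ Gxy /imsetP[b bE ->].
    have [a' aE ab] := suppE _ _ _ _ Gxy bE.
    by exists (psi a'); rewrite ?imset_f // RR'.
  + move=> v; have /set0Pn[b bE] := E0 v.
    by apply/set0Pn; exists (psi b); apply: imset_f.
have [g gP] : exists g : I -> W * bool, forall v,
    (exists s, ((g v).1, s) \in D v) /\ psi (g v) = g' v.
  apply: (@fin_all_exists _ _ (fun v (b : W * bool) =>
    (exists s, (b.1, s) \in D v) /\ psi b = g' v)) => v.
  (* The vertex comes from the surviving label, but the sign from [g'], with the switching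
     undone. *)
  have [s /imsetP[a aD ag]] := gD v; exists (a.1, (g' v).2 (+) tau a.1); split.
    by exists a.2; case: a aD {ag}.
  by rewrite /psi /= addbK; case: (g' v) ag => x t [-> _].
exists g; split=> [v|c x y Gxy]; first by case: (gP v).
rewrite -RR'; have := gR _ _ _ Gxy.
by case: (gP x) => _ <-; case: (gP y) => _ <-.
Qed.

Definition switched_by (V : finType) (G : signed_graph V) (sigma : V -> bool)
    (G' : signed_graph V) : Prop :=
  forall x y,
    blue G' x y = (if sigma x (+) sigma y then red G x y else blue G x y) /\
    red G' x y = (if sigma x (+) sigma y then blue G x y else red G x y).

(** Two switchings at the same vertex cancel, so only parities of occurrences count. *)
Lemma switch_seq (V : finType) (G : signed_graph V) (s : seq V) :
  switched_by G (fun x => odd (count_mem x s)) (foldl (@switch V) G s).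
Proof.
elim: s G => [|v s IHs] G x y //=; have [-> ->] := IHs (switch G v) x y.
rewrite /= /switch_rel !oddD ![v == _]eq_sym.
by case: (x == v); case: (y == v); case: (odd _); case: (odd _).
Qed.

Lemma switching_equivalentP (V : finType) (G G' : signed_graph V) :
  switching_equivalent G G' <-> exists sigma, switched_by G sigma G'.
Proof.
split=> [[s [bs rs]]|[sigma h]].
  by exists (fun x => odd (count_mem x s)) => x y; rewrite -bs -rs; apply: switch_seq.
exists (enum sigma); split=> x y; have [hb hr] := h x y;
  have [sb sr] := switch_seq G (enum sigma) x y; rewrite ?sb ?sr ?hb ?hr;
  by rewrite !count_uniq_mem ?enum_uniq // !mem_enum !oddb.
Qed.

Lemma homomorphismP (V W : finType) (G : signed_graph V) (H : signed_graph W) f :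
  homomorphism G H f <->
  exists sigma : V -> bool, forall x y,
    (blue G x y -> label_rel H false (f x, sigma x) (f y, sigma y)) /\
    (red G x y -> label_rel H true (f x, sigma x) (f y, sigma y)).
Proof.
split.
  case=> G' /switching_equivalentP[sigma h] fP; exists sigma => x y.
  have [] := fP x y; have [-> ->] := h x y; rewrite /label_rel /=.
  by case: (sigma x); case: (sigma y) => /=.
case=> sigma fP; exists (foldl (@switch V) G (enum sigma)).
  by exists (enum sigma).
move=> x y; have [-> ->] := switch_seq G (enum sigma) x y.
rewrite !count_uniq_mem ?enum_uniq // !mem_enum !oddb.
have [] := fP x y; rewrite /label_rel /= -!topredE /=.
by case: (sigma x); case: (sigma y).
Qed.

Lemma sac_decides_copy (V W : finType) (H : signed_graph V) (K : signed_graph W) :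
  switching_equivalent_to_copy H K -> sac_decides (label_rel K) ->
  sac_decides (label_rel H).
Proof.
case=> H' /switching_equivalentP[tau h] [f f_bij fP].
apply: (@sac_decides_transfer _ _ _ _ f tau) => [|c [x s] [y t]]; first exact: bij_inj.
rewrite /label_rel /=; have [-> ->] := fP x y; have [-> ->] := h x y.
by case: c; case: s; case: t; case: (tau x); case: (tau y).
Qed.

(** * The encoding of instances *)

Lemma nth_allpairs_index (S T U : Type) (f : S -> T -> U) s t x0 y0 z0 i j :
  i < size s -> j < size t ->
  nth z0 [seq f x y | x <- s, y <- t] (i * size t + j) =
  f (nth x0 s i) (nth y0 t j).
Proof.
elim: s i => // x s IHs [|i] /= si tj; rewrite nth_cat size_map.
  by rewrite mul0n add0n tj (nth_map y0).
by rewrite mulSn -addnA ltnNge leq_addr /= addKn IHs.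
Qed.

Section Encoding.

Variables (W : finType) (I : list_instance W).

Let n := li_order I.
Let w := list_instance_encode I.

Lemma size_list_instance_encode :
  size w = n.+1 + 2 * (n * n) + n * #|W|.
Proof.
rewrite /w /list_instance_encode size_cat size_nseq /= !size_cat !size_allpairs.
by rewrite -!cardE card_ord; lia.
Qed.

Lemma encode_prefix i : i <= n -> nth false w i = (i < n).
Proof.
move=> ile; rewrite /w /list_instance_encode nth_cat size_nseq nth_nseq.
case: ltnP => // nle.
by have -> : i - li_order I = 0 by apply/eqP; rewrite subn_eq0.
Qed.

Lemma encode_skip k : nth false w (n.+1 + k) =
  nth false ([seq blue (li_graph I) x y | x <- enum 'I_n, y <- enum 'I_n] ++
    [seq red (li_graph I) x y | x <- enum 'I_n, y <- enum 'I_n] ++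
    [seq a \in li_lists I x | x <- enum 'I_n, a <- enum W]) k.
Proof.
rewrite /w /list_instance_encode nth_cat size_nseq addSn -addnS.
by rewrite ltnNge leq_addr /= addKn.
Qed.

Definition edges_of (c : bool) : rel 'I_n :=
  if c then red (li_graph I) else blue (li_graph I).

Lemma edge_bitE c (x y : 'I_n) : edge_bit n w c x y = edges_of c x y.
Proof.
have szV : size (enum 'I_n) = n by rewrite -cardE card_ord.
have pos : x * n + y < n * n.
  by have := ltn_ord x; have := ltn_ord y; nia.
have pairs (f : rel 'I_n) :
    nth false [seq f x y | x <- enum 'I_n, y <- enum 'I_n] (x * n + y) = f x y.
  have := @nth_allpairs_index _ _ _ f (enum 'I_n) (enum 'I_n) x x false x y.
  by rewrite szV !nth_ord_enum => ->.
rewrite /edge_bit -addnA encode_skip nth_cat size_allpairs szV /edges_of.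
case: c.
  rewrite mul1n ltnNge leq_addr /= addKn nth_cat size_allpairs szV pos.
  exact: pairs.
by rewrite mul0n add0n pos pairs.
Qed.

Lemma list_bitE (x : 'I_n) (a : W) :
  list_bit #|W| n w x (index a (enum W)) = (a \in li_lists I x).
Proof.
have szV : size (enum 'I_n) = n by rewrite -cardE card_ord.
have aW : index a (enum W) < size (enum W) by rewrite index_mem mem_enum.
have := @nth_allpairs_index _ _ _ (fun x a => a \in li_lists I x) (enum 'I_n)
  (enum W) x a false x (index a (enum W)).
rewrite szV aW nth_ord_enum nth_index ?mem_enum // => /(_ (ltn_ord x) isT) <-.
rewrite /list_bit -addnA encode_skip nth_cat size_allpairs szV -cardE.
rewrite ltnNge (_ : n * n <= _) /=; last by lia.
rewrite nth_cat size_allpairs szV ltnNge (_ : n * n <= _) /=; last by lia.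
by congr (nth _ _ _); lia.
Qed.

End Encoding.

(** * Polynomial-time decision of list homomorphism *)

Lemma sac_decides_polynomial (V : finType) (H : signed_graph V) (x0 : V) :
  sac_decides (label_rel H) -> polynomial_time_solvable (List_S_Hom H).
Proof.
(* The index ignores the sign, so each list bit governs both labels of a target vertex. *)
move=> decH; pose idx (a : V * bool) := index a.1 (enum V).
exists (sac_machine (label_rel H) #|V| idx).
exists (time_coefficient (V * bool)%type #|V|), 5.
move=> I /=; set w := list_instance_encode I; pose n := li_order I.
have szw := size_list_instance_encode I; rewrite -/w -/n in szw.
have nw : n < size w by rewrite szw; lia.
have [b [out sound complete]] :=
  @sac_machine_correct _ (label_rel H) #|V| idx n w nw (@encode_prefix V I) szw.
exists b; split=> //.
split=> [/sound[D [D0 certD]]|[f /homomorphismP[sigma fP] fL]].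
- pose G := @edges_of V I.
  have supp E : arc_consistent (label_rel H) #|V| idx n w E ->
      supported (label_rel H) G (fun v => E (val v)).
    move=> [acE _] c x y a Gxy aE.
    have := subsetP (acE c x y (ltn_ord x) (ltn_ord y) _) a aE.
    rewrite edge_bitE => /(_ Gxy); rewrite inE => /exists_inP[a' a'E Ra'].
    by exists a'.
  have [|||g [gD gR]] := decH _ G (fun v => D (val v)).
  + by case; [exact: red_sym | exact: blue_sym].
  + by move=> v; apply: D0 (ltn_ord v).
  + move=> u a aD; have [E [sE Eu acE E0]] := certD _ _ (ltn_ord u) aD.
    exists (fun v => E (val v)); split=> // [|v]; last exact: E0 (ltn_ord v).
    exact: supp.
  exists (fun v => (g v).1).
    apply/homomorphismP; exists (fun v => (g v).2) => x y.
    rewrite -!surjective_pairing; split=> [Gxy|Gxy]; first exact: (gR false).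
    exact: (gR true).
  move=> v; have [s sD] := gD v.
  (* The domains [D] come without a list condition; membership in the list is read off the
     certificate of the label. *)
  have [E [sE Ev [_ lE] E0]] := certD _ _ (ltn_ord v) sD.
  rewrite -list_bitE; apply: (lE v ((g v).1, s)) => //; first by rewrite Ev set11.
  by rewrite /idx /= cardE index_mem mem_enum.
apply: complete.
(* The machine indexes vertices by all natural numbers; [x0] is a default value beyond the
   instance. *)
exists (fun k => if insub k is Some v then (f v, sigma v) else (x0, false)).
split=> [c i j lt_i_n lt_j_n|j lt_j_n].
  rewrite !insubT -[i]/(val (Ordinal lt_i_n)) -[j]/(val (Ordinal lt_j_n)).
  rewrite edge_bitE /edges_of.
  by have [] := fP (Ordinal lt_i_n) (Ordinal lt_j_n); case: c.
by rewrite insubT => _; rewrite (list_bitE (Ordinal lt_j_n)); apply: fL.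
Qed.

Theorem theorem12 (V : finType) (H : signed_graph V) :
  switching_equivalent_to_copy H H0 \/
  switching_equivalent_to_copy H H1 \/
  (exists l : nat, [/\ odd l, 3 <= l & switching_equivalent_to_copy H (Hl l)]) ->
  polynomial_time_solvable (List_S_Hom H).
Proof.
have solvable (W : finType) (K : signed_graph W) (y0 : W) :
    switching_equivalent_to_copy H K -> sac_decides (label_rel K) ->
    polynomial_time_solvable (List_S_Hom H).
  (* The inverse [g] of the isomorphism turns a vertex of the concrete graph into the default vertex
     of [V]. *)
  move=> HK decK; have [H' _ [f [g _ _] _]] := HK.
  exact: (sac_decides_polynomial (g y0) (sac_decides_copy HK decK)).
case=> [HK|[HK|[l [odd_l _ HK]]]].
- exact: solvable ord0 HK sac_decides_H0.
- exact: solvable ord0 HK sac_decides_H1.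
- exact: solvable (inl ord0) HK (sac_decides_Hl odd_l).
Qed.
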